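(* Fix $q\in(0,1)$ and a partition $\mu$, and let $$I_\mu(\cdot\,;q):=\sum_{\nu\subseteq\mu}\sigma(\mu,\nu;q)\,S_\nu\in\mathrm{Sym},\qquad \sigma(\mu,\nu;q):=(-1)^{|\mu|-|\nu|}q^{n(\mu)-n(\mu')-n(\nu)+n(\nu')}\det\left[\frac{1}{(q;q)_{\mu_i-\nu_k-i+k}}\right]_{i,k=1}^{\ell(\mu)}.$$ Then for every $X=(x_1,x_2,\dots)\in\ell^1$, $$I_\mu(X;q)=\sum_{T\in\mathrm{Tab}(\mu)}\prod_{(i,j)\in\mu}\bigl(x_{T(i,j)}-q^{T(i,j)+i-j-1}\bigr),$$ where the series on the right converges absolutely, and it also converges absolutely after all the products are expanded (parentheses removed).
   Context: $\mathrm{Sym}$ is the algebra of symmetric functions over $\mathbb{R}$, $S_\nu$ the Schur function; elements of $\mathrm{Sym}$ are evaluated at $X\in\ell^1$ (real absolutely summable sequences) by substituting $x_1,x_2,\dots$. Partitions are identified with Young diagrams; $\ell(\mu)$ is the length, $|\mu|$ the size, $\mu'$ the transposed diagram, $n(\mu)=\sum_i(i-1)\mu_i$. $(q;q)_r=\prod_{i=1}^r(1-q^i)$, and $1/(q;q)_r:=0$ for negative integers $r$. A reverse tableau of shape $\mu$ is a filling of the boxes of $\mu$ by positive integers which weakly decrease along rows from left to right and strictly decrease down columns; $\mathrm{Tab}(\mu)$ is the set of all of them, and $T(i,j)$ is the entry of box $(i,j)$ (row $i$, column $j$). *)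

(* Defs.v *)
From HB Require Import structures.
From mathcomp Require Import all_boot all_order all_algebra finmap.
From mathcomp Require Import all_classical all_reals all_analysis.

Set Implicit Arguments.
Unset Strict Implicit.
Unset Printing Implicit Defensive.
Import Order.TTheory GRing.Theory Num.Theory.

Local Open Scope classical_set_scope.
Local Open Scope ring_scope.

(* Rows, columns and parts are numbered from 0: the box usually written (i, j)
   has [brow = i - 1] and [bcol = j - 1], and mu_i is [nth 0 mu (i - 1)].  A
   real sequence (x_1, x_2, ...) is a function [X : nat -> R] with
   x_k = X (k - 1); the k-th variable of a formal series has index k - 1.
   Entries of tableaux are positive integers, not shifted. *)

Definition is_intpart (s : seq nat) : bool := sorted geq s && (0%N \notin s).

Record intpart := Intpart { parts :> seq nat; _ : is_intpart parts }.

HB.instance Definition _ := [isSub for parts].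
HB.instance Definition _ := [Choice of intpart by <:].

Definition transpose_seq (s : seq nat) : seq nat :=
  [seq count (fun p => j < p)%N s | j <- iota 0 (head 0%N s)].

Lemma transpose_subproof (mu : intpart) : is_intpart (transpose_seq mu).
Proof.
case: mu => s /= /andP[_ s0]; rewrite /is_intpart /transpose_seq.
apply/andP; split.
  apply: (homo_sorted (e := ltn)); last exact: iota_ltn_sorted.
  move=> i j ij; rewrite /geq /=; apply: sub_count => p /=.
  by apply: leq_ltn_trans; exact: ltnW.
apply/mapP => -[j]; rewrite mem_iota /= add0n.
by case: s {s0} => //= p s ->.
Qed.

Definition transpose (mu : intpart) : intpart :=
  Intpart (transpose_subproof mu).

Definition n_stat (mu : intpart) : nat :=
  (\sum_(i < size mu) i * nth 0%N mu i)%N.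

Definition subdiagram (nu mu : intpart) : Prop :=
  forall i, (nth 0%N nu i <= nth 0%N mu i)%N.

Lemma finite_subdiagram (mu : intpart) :
  finite_set [set nu | subdiagram nu mu].
Proof.
pose B := ((size mu).+1 * (sumn mu).+1)%N.
pose dec (x : 'I_(size mu).+1 * {ffun 'I_(size mu) -> 'I_(sumn mu).+1}) :
  intpart := insubd mu (mkseq (fun i => if insub i is Some j
                            then nat_of_ord (x.2 j) else 0%N) x.1).
apply: (@sub_finite_set _ _ (dec @` setT)); last exact/finite_image/finite_finset.
move=> nu numu /=.
have szle : (size nu <= size mu)%N.
  rewrite leqNgt; apply/negP => lt.
  have := numu (size mu); rewrite (nth_default _ (leqnn _)) leqn0 => /eqP e0.
  have /andP[_] := valP nu; rewrite -[X in X \notin _]e0.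
  by rewrite mem_nth.
have ptle i : (nth 0%N nu i < (sumn mu).+1)%N.
  rewrite ltnS; apply: leq_trans (numu i) _.
  elim: (parts mu) i => [|p s IH] [|i] //=; first exact: leq_addr.
  exact: leq_trans (IH i) (leq_addl _ _).
exists (inord (size nu), [ffun i : 'I_(size mu) => inord (nth 0%N nu i)]) => //.
apply: val_inj; rewrite /dec /= inordK ?ltnS //.
have -> : mkseq (fun i : nat => if (insub i : option 'I_(size mu)) is Some j then
   nat_of_ord ([ffun i : 'I_(size mu) => inord (nth 0%N nu i) : 'I_(sumn mu).+1] j)
   else 0%N) (size nu) = nu.
  apply: (@eq_from_nth _ 0%N); rewrite size_mkseq // => i isz.
  rewrite nth_mkseq //; case: insubP => [j _ ji|]; last by rewrite (leq_trans isz).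
  by rewrite ffunE inordK ?ptle //= ji.
by rewrite val_insubd (valP nu).
Qed.

Section Tableaux.
Variable mu : intpart.

Definition box := {i : 'I_(size mu) & 'I_(nth 0%N mu i)}.
Definition brow (b : box) : nat := tag b.
Definition bcol (b : box) : nat := tagged b.

Definition filling := {ffun box -> nat}.

Definition Tab : set filling := [set T |
  [/\ forall b, (0 < T b)%N,
      forall b c, brow b = brow c -> (bcol b <= bcol c)%N -> (T c <= T b)%N &
      forall b c, bcol b = bcol c -> (brow b < brow c)%N -> (T c < T b)%N]].

Definition SSYT : set filling := [set T |
  [/\ forall b, (0 < T b)%N,
      forall b c, brow b = brow c -> (bcol b <= bcol c)%N -> (T b <= T c)%N &
      forall b c, bcol b = bcol c -> (brow b < brow c)%N -> (T b < T c)%N]].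

End Tableaux.

(* Exponent vectors of monomials in countably many variables. *)
Definition monomial := {fsfun nat -> nat with 0%N}.

Definition mondeg (m : monomial) : nat := (\sum_(i <- finsupp m) m i)%N.

Definition has_weight (nu : intpart) (T : filling nu) (m : monomial) : Prop :=
  forall i, #|[pred b | T b == i.+1]| = m i.

Lemma finite_weight (nu : intpart) (m : monomial) :
  finite_set [set T : filling nu | SSYT T /\ has_weight T m].
Proof.
pose F := finsupp m.
pose dec (x : {ffun box nu -> option F}) : filling nu :=
  [ffun b => if x b is Some i then (val i).+1 else 0%N].
apply: (@sub_finite_set _ _ (dec @` setT)); last exact/finite_image/finite_finset.
move=> T [[Tpos _ _] Tw] /=.
exists [ffun b => insub (T b).-1] => //; apply/ffunP => b; rewrite !ffunE.
have Tb := Tpos b.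
case: insubP => [i _ ->|]; first by rewrite prednK.
rewrite mem_finsupp negbK -Tw prednK // => /eqP/card0_eq/(_ b).
by rewrite !inE eqxx.
Qed.

Section SymmetricFunctions.
Variable R : realType.

(* A formal power series in countably many variables, given by its
   coefficients. *)
Definition fpseries := monomial -> R^o.

Definition symmetric_function : set fpseries := [set f |
  (exists d, forall m, f m != 0 -> (mondeg m <= d)%N) /\
  (forall s : nat -> nat, bijective s -> forall m m' : monomial,
     (forall i, m' i = m (s i)) -> f m' = f m)].

(* The coefficient of a monomial in S_nu is the number of semistandard tableaux
   of shape nu and that weight; the set is finite by [finite_weight]. *)
Definition schur (nu : intpart) : fpseries :=
  fun m => #|` fset_set [set T : filling nu | SSYT T /\ has_weight T m]|%:R.

(* The sum of an absolutely convergent real family over an arbitrary set; only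
   meaningful under [summable D (EFin \o f)]. *)
Definition abs_sum (T : choiceType) (D : set T) (f : T -> R) : R :=
  fine (\esum_(t in D) ((EFin \o f)^\+ t)%E)
  - fine (\esum_(t in D) ((EFin \o f)^\- t)%E).

Definition evalX (f : fpseries) (X : nat -> R) : R :=
  abs_sum [set: monomial] (fun m => f m * \prod_(i <- finsupp m) X i ^+ m i).

Definition ell1 : set (nat -> R) := [set X | summable setT (EFin \o X)].

Definition qpoch (q : R) (r : nat) : R := \prod_(1 <= i < r.+1) (1 - q ^+ i).

Definition inv_qpoch (q : R) (z : int) : R :=
  if z is Posz r then (qpoch q r)^-1 else 0.

Definition sigma (q : R) (mu nu : intpart) : R :=
  (-1) ^ ((sumn mu)%:Z - (sumn nu)%:Z)
  * q ^ ((n_stat mu)%:Z - (n_stat (transpose mu))%:Z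
         - (n_stat nu)%:Z + (n_stat (transpose nu))%:Z)
  * \det (\matrix_(i < size mu, k < size mu)
      inv_qpoch q ((nth 0%N mu i)%:Z - (nth 0%N nu k)%:Z - i%:Z + k%:Z)).

Definition interp (q : R) (mu : intpart) : fpseries :=
  \sum_(nu \in [set nu | subdiagram nu mu]) sigma q mu nu *: schur nu.

(* The number q^(T(i,j) + i - j - 1) for the box (i, j) = b. *)
Definition node (q : R) (mu : intpart) (T : filling mu) (b : box mu) : R :=
  q ^ ((T b)%:Z + (brow b).+1%:Z - (bcol b).+1%:Z - 1).

End SymmetricFunctions.

(* Main.v *)
(* Removing the entries 1 of a reverse tableau of shape mu and decreasing the
   others by 1 gives a reverse tableau of a shape lam such that mu / lam is a
   horizontal strip.  The theorem thus reduces to a branching rule for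
   I_mu(X; s) = \sum_nu s^(|mu| - |nu|) sigma(mu, nu) S_nu(X), namely
     I_mu(x, Y; s) = \sum_lam \prod_((i, j) in mu / lam) (x - s q^(i - j)) I_lam(Y; q s),
   summed over the lam such that mu / lam is a horizontal strip.  The entries
   of the matrix defining sigma are the coefficients of the Laurent series
   f_m(z) = z^m \prod_(k >= 0) (1 - s q^(k - m) / z), where m = mu_i - i, and
   f_(m + 1) = (z - s q^(-m - 1)) f_m.  As the horizontal strips form a product
   of intervals, both sides of the branching rule are single determinants, and
   by telescoping both are equal to the determinant of the truncations of
   f_(mu_i - i) evaluated at x, up to unitriangular factors.

   With X truncated to n variables, iterating the rule n times leaves the
   tableaux with entries at most n plus a remainder of order q^n, so the
   identity follows by absolute convergence.  Schur functions enter through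
   chains of horizontal strips; their symmetry is the commutation of two such
   steps, proved by the Bender-Knuth reflection. *)

Require Import Defs.
From HB Require Import structures.
From mathcomp Require Import all_boot all_order all_algebra finmap.
From mathcomp Require Import all_classical all_reals all_analysis.
From mathcomp Require Import perm lra zify.

Set Implicit Arguments.
Unset Strict Implicit.
Unset Printing Implicit Defensive.
Import Order.TTheory GRing.Theory Num.Theory numFieldNormedType.Exports.

Local Open Scope classical_set_scope.
Local Open Scope ring_scope.

(** * Partitions in an [L] by [B] box and horizontal strips *)

Section Rows.
Variables L B : nat.

(* Partitions with at most [L] parts, all at most [B], live in this finite
   type; [is_part] singles them out. *)
Definition rows := {ffun 'I_L -> 'I_B.+1}.
Implicit Types lam mu nu kap rho : rows.

Definition part mu (i : nat) : nat :=
  oapp (fun k : 'I_L => mu k : nat) 0%N (insub i).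

Lemma partE mu (i : 'I_L) : part mu i = mu i.
Proof. by rewrite /part valK. Qed.

Lemma part_default mu i : (L <= i)%N -> part mu i = 0%N.
Proof. by move=> Li; rewrite /part insubF // ltnNge Li. Qed.

Lemma part_le mu i : (part mu i <= B)%N.
Proof.
case: (ltnP i L) => [iL|/part_default-> //].
by rewrite (partE mu (Ordinal iL)) -ltnS.
Qed.

Definition wsize mu : nat := (\sum_i mu i)%N.

Lemma wsizeE mu : wsize mu = (\sum_(0 <= i < L) part mu i)%N.
Proof. by rewrite big_mkord; apply: eq_bigr => i _; rewrite partE. Qed.

Definition is_part mu : bool := [forall i : 'I_L, (part mu i.+1 <= mu i)%N].

Lemma is_partP mu : reflect (forall i, (part mu i.+1 <= part mu i)%N) (is_part mu).
Proof.
apply: (iffP forallP) => [h i|h i]; last by rewrite -partE.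
case: (ltnP i L) => [iL|Li]; last by rewrite !part_default // (leq_trans Li).
by rewrite (partE mu (Ordinal iL)); exact: (h (Ordinal iL)).
Qed.

Lemma part_anti mu i j : is_part mu -> (i <= j)%N -> (part mu j <= part mu i)%N.
Proof.
move=> /is_partP h; elim: j => [|j IH]; first by rewrite leqn0 => /eqP->.
rewrite leq_eqVlt => /predU1P[->//|]; rewrite ltnS => /IH; exact: leq_trans.
Qed.

(* Interlacing means that [mu / lam] is a horizontal strip. *)
Definition interlace mu lam : bool :=
  [forall i : 'I_L, part mu i.+1 <= lam i <= mu i]%N.

Lemma interlaceP mu lam :
  reflect (forall i, part mu i.+1 <= part lam i <= part mu i)%N (interlace mu lam).
Proof.
apply: (iffP forallP) => [h i|h i]; last by have := h i; rewrite !partE.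
case: (ltnP i L) => [iL|Li]; last by rewrite !part_default // (leq_trans Li).
by have := h (Ordinal iL); rewrite -!partE.
Qed.

Lemma interlace_part1 mu lam : interlace mu lam -> is_part mu.
Proof. by move=> /interlaceP h; apply/is_partP => i; have /andP[] := h i; lia. Qed.

Lemma interlace_part2 mu lam : interlace mu lam -> is_part lam.
Proof.
move=> /interlaceP h; apply/is_partP => i.
by have /andP[_ +] := h i.+1; have /andP[+ _] := h i; lia.
Qed.

Lemma interlace_le mu lam i : interlace mu lam -> (part lam i <= part mu i)%N.
Proof. by move=> /interlaceP/(_ i)/andP[]. Qed.

Lemma interlace_wsize mu lam : interlace mu lam -> (wsize lam <= wsize mu)%N.
Proof.
move=> h; apply: leq_sum => i _; rewrite -!partE; exact: interlace_le.
Qed.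

(** The upper end of the interval for row [j] of a shape from which [kap] arises by removing a
    horizontal strip. The top row of such a shape is unbounded, so there the width [B] of the box
    takes over. *)
Definition above kap (j : nat) : nat := if j is j'.+1 then part kap j' else B.

(** Seen from the smaller shape the condition is again a product of intervals, one per row of [nu];
    this allows sums over [nu] to be distributed over the columns of a determinant. *)
Lemma interlace_above nu kap :
  interlace nu kap = [forall j : 'I_L, kap j <= nu j <= above kap j]%N.
Proof.
apply/interlaceP/forallP => [h [[|j] jL]|h i] /=.
- have := h 0%N; rewrite -!partE /= => /andP[_ ->]; exact: part_le.
- have /andP[_] := h j.+1; have /andP[+ _] := h j; rewrite -!partE /=; lia.
have hj j : (part kap j <= part nu j <= above kap j)%N.
  case: (ltnP j L) => [jL|Lj]; last by rewrite !part_default.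
  by have := h (Ordinal jL); rewrite -!partE.
by have /andP[_ /= ->] := hj i.+1; have /andP[-> _] := hj i.
Qed.

(** The strictly decreasing exponents lam_i - i (rows numbered from 1), translated by [L] to make
    them natural numbers. *)
Definition shifted lam (i : nat) : nat := (part lam i + (L - i.+1))%N.

(** * Sums of determinants over products of intervals *)

Section DetMultilinear.
Variable A : comPzRingType.
Implicit Types (Q : 'I_L -> pred 'I_B.+1).

(** Multilinearity in the rows: in the Leibniz expansion each row contributes one factor, so the sum
    over independent choices [f i] distributes over the product. *)
Lemma det_row_sum Q (a : 'I_L -> 'I_B.+1 -> A) (F : 'I_L -> 'I_B.+1 -> 'I_L -> A) :
  \sum_(f : rows | [forall i, Q i (f i)])
     (\prod_i a i (f i)) * \det (\matrix_(i, j) F i (f i) j) =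
  \det (\matrix_(i, j) \sum_(v | Q i v) a i v * F i v j).
Proof.
under eq_bigr do rewrite big_distrr /=.
rewrite exchange_big /=; apply: eq_bigr => s _.
under [in RHS]eq_bigr do rewrite mxE.
rewrite bigA_distr_big_dep big_distrr /=.
apply: eq_big => [f|f _]; first by apply/forallP/familyP.
rewrite mulrCA; congr (_ * _); rewrite -big_split /=.
by apply: eq_bigr => i _; rewrite mxE.
Qed.

Lemma det_col_sum Q (a : 'I_L -> 'I_B.+1 -> A) (F : 'I_L -> 'I_L -> 'I_B.+1 -> A) :
  \sum_(f : rows | [forall j, Q j (f j)])
     (\prod_j a j (f j)) * \det (\matrix_(i, j) F i j (f j)) =
  \det (\matrix_(i, j) \sum_(v | Q j v) a j v * F i j v).
Proof.
rewrite -[RHS]det_tr.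
under eq_bigr do rewrite -det_tr.
transitivity (\det (\matrix_(i, j) \sum_(v | Q i v) a i v * F j i v)).
  rewrite -(det_row_sum Q a (fun j v i => F i j v)).
  by apply: eq_bigr => f _; congr (_ * \det _); apply/matrixP => i j; rewrite !mxE.
by congr (\det _); apply/matrixP => i j; rewrite !mxE.
Qed.

End DetMultilinear.

(** * The determinantal branching rule *)

Section Branching.
(** [c u n] models the coefficient of z^n in a Laurent series f_u. The hypotheses say that f_0 has
    no positive powers and that f_(u+1) = (z - rho u) f_u, read at positive exponents. *)
Variables (A : comNzRingType) (c : nat -> nat -> A) (rho : nat -> A) (x : A).
Hypothesis c0S : forall n, c 0 n.+1 = 0.
Hypothesis cSS : forall u n, c u.+1 n.+1 = c u n - rho u * c u n.+1.

Lemma branch_coef_gt u n : (u < n)%N -> c u n = 0.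
Proof.
elim: u n => [|u IH] [|n] // un; rewrite cSS !IH ?mulr0 ?subr0 //; lia.
Qed.

(* [T m k] is the part of the polynomial [\sum_n c m n * x ^ n] of
   degree above [k], divided by [x ^ k.+1]. *)
Let N := (B + L)%N.
Let T m k := \sum_(k <= n < N) x ^+ (n - k) * c m n.+1.

(** Multiplying the series by z - rho b multiplies its tail by x - rho b, except that the
    coefficient of degree [k] crosses the cutoff. *)
Lemma branch_tailS b k : (b < N)%N -> T b.+1 k = c b k + (x - rho b) * T b k.
Proof.
move=> bN; rewrite /T.
under eq_bigr do rewrite cSS mulrBr.
rewrite sumrB mulrBl mulr_sumr addrA; congr (_ - _); last first.
  by rewrite mulr_sumr; apply: eq_bigr => n _; rewrite mulrCA.
case: (leqP N k) => [Nk|kN].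
  by rewrite !big_geq // branch_coef_gt ?addr0 //; lia.
rewrite big_ltn // subnn expr0 mul1r; congr (_ + _).
(* Multiplication by [x] produces one extra term at the top; its coefficient has degree [N], which
   exceeds [b], so it vanishes. *)
case: N bN kN => // N' bN kN; rewrite big_add1 /= [RHS]big_nat_recr //=.
rewrite (@branch_coef_gt b N'.+1) ?mulr0 ?addr0 //.
by apply: eq_big_nat => n /andP[kn _]; rewrite subSn // exprS mulrA.
Qed.

(** Unrolling [branch_tailS] from [a] to [b]. With [a, b) the range of one row of [lam], a row sum
    becomes a combination of two tails. *)
Lemma branch_telescope a b k : (a <= b <= N)%N ->
  \sum_(a <= u < b) (\prod_(u.+1 <= v < b) (x - rho v)) * c u k =
  T b k - (\prod_(a <= v < b) (x - rho v)) * T a k.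
Proof.
move=> /andP[]; elim: b => [|b IH] ab bN.
  by move: ab; rewrite leqn0 => /eqP->; rewrite !big_geq // mul1r subrr.
move: ab; rewrite leq_eqVlt => /predU1P[->|]; first by rewrite !big_geq // mul1r subrr.
rewrite ltnS => ab; rewrite big_nat_recr //= [\prod_(b.+1 <= v < b.+1) _]big_geq // mul1r.
rewrite branch_tailS // big_nat_recr //=.
transitivity ((x - rho b) * (T b k - (\prod_(a <= v < b) (x - rho v)) * T a k) + c b k).
  rewrite -IH //; last exact: ltnW.
  congr (_ + _); rewrite mulr_sumr; apply: eq_big_nat => u /andP[_ ub].
  by rewrite big_nat_recr //= mulrA [_ * (x - _)]mulrC.
by rewrite addrC mulrBr addrA mulrA [_ * (\prod_(_ <= v < _) _)]mulrC.
Qed.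

Let Wt mu lam (i : nat) := \prod_(shifted lam i <= a < shifted mu i) (x - rho a.+1).

(** The interlacing condition lets each row of [lam] vary independently. The sum over row [i]
    telescopes to the tail at [bot i] minus [W i] times the tail at [bot i.+1], so the matrix is the
    upper unitriangular [U] times the matrix of tails. *)
Lemma branching_rows mu kap : is_part mu ->
  \sum_(lam | interlace mu lam) (\prod_(i < L) Wt mu lam i) *
     \det (\matrix_(i < L, j < L) c (shifted lam i) (shifted kap j)) =
  \det (\matrix_(i < L, j < L) T (shifted mu i).+1 (shifted kap j)).
Proof.
move=> mup.
pose sh (i : 'I_L) (v : 'I_B.+1) := (v + (L - i.+1))%N.
(* The shifted values of row [i] of [lam] run from [bot i.+1] to [bot i] exclusive, so the ranges of
   consecutive rows abut. *)
pose bot (i : nat) := (part mu i + (L - i))%N.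
have botS (i : 'I_L) : bot i = (shifted mu i).+1.
  by rewrite /bot /shifted; have := ltn_ord i; lia.
have LE : forall lam (i : 'I_L), shifted lam i = sh i (lam i).
  by move=> lam i; rewrite /sh -partE.
pose a (i : 'I_L) v := \prod_(sh i v <= b < shifted mu i) (x - rho b.+1).
transitivity (\det (\matrix_(i < L, j < L)
    \sum_(v : 'I_B.+1 | (part mu i.+1 <= v <= mu i)%N) a i v * c (sh i v) (shifted kap j))).
  rewrite -(det_row_sum (fun i v => part mu i.+1 <= v <= mu i)%N a
     (fun i v j => c (sh i v) (shifted kap j))).
  apply: eq_bigr => lam _; congr (_ * _).
    by apply: eq_bigr => i _; rewrite /a -LE.
  by congr (\det _); apply/matrixP => i j; rewrite !mxE LE.
pose W (i : nat) := \prod_(bot i.+1 <= v < bot i) (x - rho v).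
pose U : 'M[A]_L := \matrix_(i, j) ((i == j)%:R - W i * (i.+1 == j)%:R).
pose TT : 'M[A]_L := \matrix_(i, j) T (bot i) (shifted kap j).
have -> : (\matrix_(i < L, j < L) T (shifted mu i).+1 (shifted kap j)) = TT.
  by apply/matrixP => i j; rewrite !mxE botS.
have detU : \det U = 1.
  rewrite -det_tr det_trig.
    apply: big1 => i _; rewrite !mxE eqxx /= [_ == _]negbTE ?mulr0 ?subr0 //.
    by rewrite eqn_leq ltnn.
  apply/is_trig_mxP => i j ij; rewrite !mxE.
  rewrite [_ == _]negbTE 1?[_ == _]negbTE ?mulr0 ?subr0 //; apply/eqP; first lia.
  by move=> e; move: ij; rewrite e ltnn.
rewrite -[RHS]mul1r -detU -det_mulmx; congr (\det _).
apply/matrixP => i j; rewrite !mxE.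
have bi : (bot i.+1 <= bot i <= N)%N.
  by rewrite /bot /N; have := part_anti mup (leqnSn i); have := part_le mu i; lia.
transitivity (T (bot i) (shifted kap j) - W i * T (bot i.+1) (shifted kap j)).
  rewrite -branch_telescope //.
  have -> : \sum_(bot i.+1 <= u < bot i)
       (\prod_(u.+1 <= v < bot i) (x - rho v)) * c u (shifted kap j)
    = \sum_(0 <= v < B.+1 | (part mu i.+1 <= v <= mu i)%N)
         (\prod_(v + (L - i.+1) <= b < shifted mu i) (x - rho b.+1)) *
           c (v + (L - i.+1))%N (shifted kap j).
    have e1 : bot i.+1 = (part mu i.+1 + (L - i.+1))%N by [].
    have e2 : bot i = ((mu i).+1 + (L - i.+1))%N.
      by rewrite botS /shifted partE.
    rewrite e1 e2 big_addn addnK.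
    rewrite (big_nat_widen _ _ B.+1) // (big_nat_widenl _ 0%N) //=.
    apply: eq_big => [v|v _]; first by rewrite ltnS andbC.
    by rewrite -{1}addSn addSn -{1}[(_ + _).+1]addn1 -e2 botS big_addn subn1; congr (_ * _);
      apply: eq_bigr => b _; rewrite addn1.
  by rewrite big_mkord.
transitivity (\sum_(k < L) ((i == k)%:R * TT k j - W i * ((i.+1 == k)%:R * TT k j))); last first.
  by apply: eq_bigr => k _; rewrite !mxE mulrBl mulrA.
rewrite sumrB -mulr_sumr (bigD1 i) //= eqxx mul1r mxE big1 ?addr0; last first.
  by move=> k /negbTE; rewrite eq_sym => ->; rewrite mul0r.
congr (_ - _ * _).
case: (ltnP i.+1 L) => iL.
  rewrite (bigD1 (Ordinal iL)) //= eqxx mul1r mxE big1 ?addr0 // => k.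
  by rewrite eq_sym -val_eqE => /negbTE/= ->; rewrite mul0r.
rewrite big1 => [|k _]; last first.
  rewrite [_ == _]negbTE ?mul0r //; have := ltn_ord k; apply: contraTneq => <-; lia.
(* Below the last row the tail is that of f_0, which has no positive powers. *)
have -> : bot i.+1 = 0%N by rewrite /bot part_default //; lia.
by rewrite /T big1 // => n _; rewrite c0S mulr0.
Qed.

(** The dual computation: summing over row [j] of [nu] gives the tail beyond [shifted kap j] minus a
    power of [x] times the tail beyond [top j]. This is right multiplication of the same matrix of
    tails by the upper unitriangular [V]. *)
Lemma branching_cols mu kap : is_part kap ->
  \sum_(nu | interlace nu kap) x ^+ (wsize nu - wsize kap) *
     \det (\matrix_(i < L, j < L) c (shifted mu i).+1 (shifted nu j).+1) =
  \det (\matrix_(i < L, j < L) T (shifted mu i).+1 (shifted kap j)).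
Proof.
move=> kapp.
pose sh (j : 'I_L) (v : 'I_B.+1) := (v + (L - j.+1))%N.
(* For j > 0 this is the shifted part of [kap] in the preceding row; for j = 0 it is [N], where the
   tail is empty. *)
pose top (j : nat) := (above kap j + (L - j))%N.
transitivity (\det (\matrix_(i < L, j < L)
    \sum_(v : 'I_B.+1 | (kap j <= v <= above kap j)%N)
       x ^+ (v - kap j) * c (shifted mu i).+1 (sh j v).+1)).
  rewrite -(det_col_sum (fun j v => kap j <= v <= above kap j)%N
     (fun j v => x ^+ (v - kap j)) (fun i j v => c (shifted mu i).+1 (sh j v).+1)).
  apply: eq_big => [nu|nu nuk]; first exact: interlace_above.
  congr (_ * _); last by congr (\det _); apply/matrixP => i j; rewrite !mxE {2}/shifted partE.
  rewrite prodrXr; congr (_ ^+ _).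
  rewrite sumnB // => i _; rewrite -!partE; exact: interlace_le.
pose V : 'M[A]_L := \matrix_(k, j)
  ((k == j)%:R - x ^+ (top j - shifted kap j) * (k.+1 == j)%:R).
have detV : \det V = 1.
  rewrite -det_tr det_trig.
    apply: big1 => i _; rewrite !mxE eqxx /= [_ == _]negbTE ?mulr0 ?subr0 //.
    by rewrite eqn_leq ltnn.
  apply/is_trig_mxP => i j ij; rewrite !mxE.
  rewrite [_ == _]negbTE 1?[_ == _]negbTE ?mulr0 ?subr0 //; apply/eqP; first lia.
  by move=> e; move: ij; rewrite e ltnn.
rewrite -[RHS]mulr1 -detV -det_mulmx; congr (\det _).
apply/matrixP => i j; rewrite !mxE.
set m := (shifted mu i).+1.
have jL := ltn_ord j.
have tj : (shifted kap j <= top j <= N)%N.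
  rewrite /shifted /top /N /above; have := part_le kap j.
  case: (nat_of_ord j) jL => [|j'] jL; first lia.
  by have := part_anti kapp (leqnSn j'); have := part_le kap j'; lia.
transitivity (T m (shifted kap j) - x ^+ (top j - shifted kap j) * T m (top j)).
  have /andP[tj1 tj2] := tj.
  rewrite {1}/T (big_cat_nat tj1 tj2) /= mulr_sumr.
  rewrite [X in _ + X - _](_ : _ =
     \sum_(top j <= n < N) x ^+ (top j - shifted kap j) * (x ^+ (n - top j) * c m n.+1)).
    rewrite addrK.
    have -> : shifted kap j = (kap j + (L - j.+1))%N by rewrite /shifted partE.
    have -> : top j = ((above kap j).+1 + (L - j.+1))%N by rewrite /top; lia.
    rewrite big_addn addnK (big_nat_widen _ _ B.+1); last first.
      by rewrite /above; case: (nat_of_ord j) => // j'; rewrite ltnS part_le.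
    rewrite (big_nat_widenl _ 0%N) // big_mkord.
    apply: eq_big => [v|v _]; first by rewrite /= ltnS andbC.
    by rewrite subnDr.
  apply: eq_big_nat => n /andP[tn _]; rewrite mulrA -exprD; congr (x ^+ _ * _); lia.
pose t (k : 'I_L) := T m (shifted kap k).
transitivity (\sum_k (t k * (k == j)%:R -
   x ^+ (top j - shifted kap j) * (t k * (k.+1 == j)%:R))); last first.
  by apply: eq_bigr => k _; rewrite !mxE mulrBr [in RHS]mulrCA.
rewrite sumrB -mulr_sumr (bigD1 j) //= eqxx mulr1 big1 ?addr0; last first.
  by move=> k /negbTE ->; rewrite mulr0.
congr (_ - _ * _).
case: (posnP j) => [j0|j0].
  rewrite big1 => [|k _]; last by rewrite j0 /= mulr0.
  by rewrite /T big_geq // /top j0 /N /above; lia.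
have jL' : (j.-1 < L)%N by lia.
rewrite (bigD1 (Ordinal jL')) //= prednK // eqxx mulr1 big1 ?addr0.
  rewrite /t /= /top /shifted /above; by case: (nat_of_ord j) j0.
move=> k; rewrite -val_eqE /= => /negbTE kj; rewrite [_ == _]negbTE ?mulr0 //.
by apply/eqP => e; move: kj; rewrite -e eqxx.
Qed.

Lemma det_branching mu kap : is_part mu -> is_part kap ->
  \sum_(lam | interlace mu lam) (\prod_(i < L) Wt mu lam i) *
     \det (\matrix_(i < L, j < L) c (shifted lam i) (shifted kap j)) =
  \sum_(nu | interlace nu kap) x ^+ (wsize nu - wsize kap) *
     \det (\matrix_(i < L, j < L) c (shifted mu i).+1 (shifted nu j).+1).
Proof. by move=> mup kapp; rewrite branching_rows // branching_cols. Qed.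

End Branching.
End Rows.

(** * Rescaled determinants and the statistic n(mu) *)

Lemma det_scale (A : comPzRingType) n (a b : 'I_n -> A) (F : 'I_n -> 'I_n -> A) :
  \det (\matrix_(i, j) (a i * F i j * b j)) =
  (\prod_i a i) * (\prod_j b j) * \det (\matrix_(i, j) F i j).
Proof.
rewrite [RHS]big_distrr /=; apply: eq_bigr => /= s _.
have -> : \prod_j b j = \prod_(i < n) b (s i) by rewrite (reindex_inj (@perm_inj _ s)).
transitivity ((-1) ^+ s * ((\prod_i a i) * (\prod_(i < n) F i (s i)) * \prod_(i < n) b (s i))).
  by rewrite -!big_split; congr (_ * _); apply: eq_bigr => i _; rewrite mxE.
rewrite [RHS]mulrCA; congr (_ * _); rewrite mulrAC; congr (_ * _).
by apply: eq_bigr => i _; rewrite mxE.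
Qed.

Lemma bin2D a b : 'C(a + b, 2) = ('C(a, 2) + 'C(b, 2) + a * b)%N.
Proof.
elim: b => [|b IH]; first by rewrite addn0 bin0n addn0 muln0 addn0.
rewrite addnS !binS IH !bin1; lia.
Qed.

Lemma double_bin2 d : ('C(d, 2) + 'C(d, 2) + d = d * d)%N.
Proof. by elim: d => // d IH; rewrite binS bin1; nia. Qed.

Lemma sumn_truncate m n (F : nat -> nat) : (m <= n)%N ->
  (forall i, m <= i -> F i = 0)%N -> (\sum_(0 <= i < n) F i = \sum_(0 <= i < m) F i)%N.
Proof.
move=> mn F0; rewrite (big_cat_nat (n := m)) //= [X in (_ + X)%N](_ : _ = 0%N) ?addn0 //.
by rewrite big_nat big1 // => i /andP[/F0].
Qed.

Lemma n_stat_wide (nu : intpart) n : (size nu <= n)%N ->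
  n_stat nu = (\sum_(0 <= i < n) i * nth 0 nu i)%N.
Proof.
move=> le; rewrite /n_stat (sumn_truncate le) ?big_mkord // => i ?.
by rewrite nth_default ?muln0.
Qed.

Lemma nth_le_head (nu : intpart) i : (nth 0 nu i <= head 0 nu)%N.
Proof.
case: nu => s; rewrite /is_intpart /= => /andP[srt _].
case: (ltnP i (size s)) => [iz|/(nth_default 0%N)-> //].
rewrite -nth0; have := sorted_leq_nth _ _ 0%N srt 0%N i; apply => //.
- by move=> a b c; rewrite /geq /= => ba cb; apply: leq_trans ba.
- by move=> a; rewrite /geq /=.
- by rewrite inE; apply: leq_ltn_trans iz.
Qed.

(** Double counting: every box contributes its column index, and along a row these indices 0, ...,
    nu_i - 1 add up to a binomial coefficient. *)
Lemma n_stat_transpose (nu : intpart) n : (size nu <= n)%N ->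
  n_stat (transpose nu) = (\sum_(0 <= i < n) 'C(nth 0 nu i, 2))%N.
Proof.
move=> le; rewrite (sumn_truncate le); last by move=> i ?; rewrite nth_default // bin0n.
rewrite big_mkord.
rewrite /n_stat /= /transpose_seq size_map size_iota.
under eq_bigr => j _.
  rewrite (nth_map 0%N) ?size_iota // nth_iota // add0n.
  rewrite -sum1_count (big_nth 0%N) big_mkord big_mkcond /= big_distrr /=.
  over.
rewrite exchange_big /=; apply: eq_bigr => i _.
rewrite -bin2_sum (big_nat_widen _ _ (head 0%N nu)) ?nth_le_head // big_mkord [RHS]big_mkcond /=.
by apply: eq_bigr => j _; case: ifP; rewrite ?muln1 ?muln0.
Qed.

(** * From integer partitions to rows in a box *)

Section RowsOf.
Variables L B : nat.

(** Faithful only if [nu] fits in the box: rows beyond [L] are dropped, and [inord] sends a part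
    larger than [B] to 0. *)
Definition rows_of (nu : intpart) : rows L B :=
  [ffun i : 'I_L => inord (nth 0%N nu i)].

Lemma part_rows_of (nu : intpart) i :
  (size nu <= L)%N -> (head 0%N nu <= B)%N -> part (rows_of nu) i = nth 0%N nu i.
Proof.
move=> sz hd; case: (ltnP i L) => [iL|Li].
  rewrite (partE _ (Ordinal iL)) ffunE inordK // ltnS.
  exact: leq_trans (nth_le_head nu i) hd.
by rewrite part_default // nth_default // (leq_trans sz).
Qed.

Lemma rows_of_part (nu : intpart) :
  (size nu <= L)%N -> (head 0%N nu <= B)%N -> is_part (rows_of nu).
Proof.
move=> sz hd; apply/is_partP => i; rewrite !part_rows_of //.
case: nu {sz hd} => s; rewrite /is_intpart /= => /andP[srt _].
case: (ltnP i.+1 (size s)) => [iz|/(nth_default 0%N)-> //].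
have := sorted_leq_nth _ _ 0%N srt i i.+1; apply => //.
- by move=> a b c; rewrite /geq /= => ba cb; apply: leq_trans ba.
- by move=> a; rewrite /geq /=.
- by rewrite inE ltnW.
Qed.

Lemma wsize_rows_of (nu : intpart) :
  (size nu <= L)%N -> (head 0%N nu <= B)%N -> wsize (rows_of nu) = sumn nu.
Proof.
move=> sz hd; rewrite wsizeE (sumn_truncate sz).
  by rewrite sumnE [RHS](big_nth 0%N); apply: eq_bigr => i _; rewrite part_rows_of.
by move=> i ?; rewrite part_rows_of // nth_default.
Qed.

End RowsOf.

Lemma subdiagram_size (nu mu : intpart) : subdiagram nu mu -> (size nu <= size mu)%N.
Proof.
move=> h; rewrite leqNgt; apply/negP => lt.
have := h (size mu); rewrite (nth_default _ (leqnn _)) leqn0 => /eqP e0.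
by have /andP[_] := valP nu; rewrite -[X in X \notin _]e0 mem_nth.
Qed.

Lemma subdiagram_head (nu mu : intpart) : subdiagram nu mu -> (head 0 nu <= head 0 mu)%N.
Proof. by move=> /(_ 0%N); rewrite !nth0. Qed.

(** * The Laurent coefficients and the determinant in sigma *)

Section Coefficients.
Variables (R : realType) (q : R).
Hypothesis hq : 0 < q < 1.

Let q0 : q != 0. Proof. by have /andP[/lt0r_neq0] := hq. Qed.

Lemma qpoch_neq0 r : qpoch q r != 0.
Proof.
rewrite /qpoch prodf_seq_neq0; apply/allP => i; rewrite mem_index_iota /= => /andP[i0 _].
have /andP[h0 h1] := hq.
by rewrite subr_eq0 eq_sym lt_eqF // exprn_ilt1 ?ltW // lt0n_neq0.
Qed.

Lemma qpochS r : qpoch q r.+1 = qpoch q r * (1 - q ^+ r.+1).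
Proof. by rewrite /qpoch big_nat_recr. Qed.

(* The coefficient of [z ^ N] in [z ^ M * \prod_(k >= 0) (1 - t * q ^ (k - M) / z)]. *)
Definition bcoef (t : R) (M N : nat) : R :=
  if (N <= M)%N then
    (-1) ^+ (M - N) * q ^+ 'C(M - N, 2) * (t / q ^+ M) ^+ (M - N) / qpoch q (M - N)
  else 0.

Lemma bcoef0S t n : bcoef t 0 n.+1 = 0. Proof. by []. Qed.

(** The identity f_(u+1) = (z - t q^(-u-1)) f_u, coefficient by coefficient; it makes [bcoef] an
    instance of the abstract branching rule with rho u = t / q^(u+1). *)
Lemma bcoefSS t u n :
  bcoef t u.+1 n.+1 = bcoef t u n - t / q ^+ u.+1 * bcoef t u n.+1.
Proof.
rewrite /bcoef ltnS subSS; case: (leqP n u) => [nu|un]; last first.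
  by rewrite ltnNge ltnW // mulr0 subr0.
case: (ltnP n u) => [nu'|un']; last first.
  have -> : n = u by apply/eqP; rewrite eqn_leq nu un'.
  by rewrite subnn !expr0 mulr0 subr0.
have [e ed] : exists e, (u - n = e.+1)%N by exists (u - n).-1; lia.
have ed' : (u - n.+1 = e)%N by lia.
rewrite ed ed' binS bin1 qpochS.
set z := t / q ^+ u.+1.
have -> : t / q ^+ u = z * q.
  by rewrite /z exprSr invfM mulrA mulfVK.
have p0 := qpoch_neq0 e; have := qpoch_neq0 e.+1; rewrite qpochS mulf_eq0 negb_or => /andP[_ p1].
set P := qpoch q e in p0 *; set D := 1 - q ^+ e.+1 in p1 *.
have -> : P^-1 = D * (P * D)^-1 by rewrite invfM mulrC mulfVK.
rewrite !mulrA -mulrBl; congr (_ / _).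
rewrite !(exprMn _ z q) exprD !(exprS (-1) e) !(exprS z e).
set a := (-1) ^+ e; set b := q ^+ 'C(e, 2); set w := z ^+ e.
have -> : q ^+ e.+1 = 1 - D by rewrite /D opprB addrC subrK.
nra.
Qed.

(** Replacing t by t q and M by M + 1 leaves the infinite product unchanged and multiplies the
    series by z. *)
Lemma bcoef_shift t M N : bcoef (t * q) M.+1 N.+1 = bcoef t M N.
Proof.
rewrite /bcoef ltnS subSS; case: leqP => // _.
by rewrite exprS invfM mulrA mulfK.
Qed.

(** Homogeneity: scaling t by [a] amounts to substituting z / a for z and multiplying by a^M. *)
Lemma bcoef_scale (a t : R) M N : a != 0 ->
  bcoef (a * t) M N = a ^+ M * bcoef t M N * (a ^+ N)^-1.
Proof.
move=> a0; rewrite /bcoef; case: leqP => [NM|]; last by rewrite mulr0 mul0r.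
have -> : a ^+ M = a ^+ (M - N) * a ^+ N by rewrite -exprD subnK.
rewrite -[a * t / _]mulrA exprMn [RHS]mulrAC mulfK ?expf_neq0 //.
by rewrite (mulrCA (_ * _) (a ^+ _)) [RHS]mulrA.
Qed.

Section Sig.
Variables L B : nat.
Implicit Types mu nu lam kap : rows L B.

(** The coefficient s^(|mu| - |nu|) sigma(mu, nu) of I_mu(X; s), in determinant form. The factor q^L
    compensates the translation by [L] in [shifted]. *)
Definition sig (s : R) mu nu : R :=
  \det (\matrix_(i < L, j < L) bcoef (s * q ^+ L) (shifted mu i) (shifted nu j)).

Lemma sig_scale (a s : R) mu nu : a != 0 ->
  sig (a * s) mu nu = a ^+ wsize mu / a ^+ wsize nu * sig s mu nu.
Proof.
move=> a0; rewrite /sig.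
under eq_mx do rewrite -mulrA bcoef_scale //.
rewrite det_scale; congr (_ * _).
rewrite prodfV !prodrXr /shifted !big_split /= !exprD.
set e := (\sum_(i < L) (L - i.+1))%N; have e0 : a ^+ e != 0 by rewrite expf_neq0.
have ws lam : (\sum_(i < L) part lam i = wsize lam)%N by rewrite wsizeE big_mkord.
by rewrite !ws invfM mulrACA divff // mulr1.
Qed.

Lemma shifted_anti mu i j : is_part mu -> (i <= j)%N -> (shifted mu j <= shifted mu i)%N.
Proof. by move=> mup ij; rewrite /shifted; have := part_anti mup ij; lia. Qed.

(** The entries in rows from [k] on and columns up to [k] vanish. This zero block has L - k rows and
    k + 1 columns, so every permutation in the Leibniz expansion meets it. *)
Lemma sig_eq0 s mu nu k : is_part mu -> is_part nu ->
  (part mu k < part nu k)%N -> sig s mu nu = 0.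
Proof.
move=> mup nup lt; apply: big1 => p _.
have kL : (k < L)%N by rewrite ltnNge; apply/negP => /(part_default nu) e; rewrite e in lt.
pose k' := Ordinal kL.
case: (pickP (fun i : 'I_L => (k <= i) && (p i <= k))%N) => [i /andP[ki pik]|h].
  rewrite (bigD1 i) //= mxE /bcoef leqNgt.
  have := shifted_anti mup ki; have := shifted_anti nup pik.
  by rewrite /shifted => h1 h2; rewrite ifF ?mul0r ?mulr0 //; lia.
(* Otherwise [p] maps the indices from [k] on injectively to those strictly beyond [k], of which
   there is one fewer. *)
have : (#|finset (fun i : 'I_L => k <= i)| < #|finset (fun i : 'I_L => k <= i)|)%N.
  rewrite -{1}(card_imset _ (@perm_inj _ p)); apply: proper_card.
  apply/properP; split.
    apply/fintype.subsetP => _ /imsetP[i + ->]; rewrite !inE => ki.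
    by have := h i; rewrite ki /= => /negbT; rewrite -ltnNge => /ltnW.
  exists k'; rewrite ?inE //; apply/imsetP => -[i]; rewrite inE => ki e.
  by have := h i; rewrite ki -e leqnn.
by rewrite ltnn.
Qed.

Lemma sig0 s : sig s [ffun=> ord0] [ffun=> ord0] = 1.
Proof.
rewrite /sig -det_tr det_trig.
  apply: big1 => i _; rewrite !mxE /bcoef leqnn subnn expr0 /qpoch big_geq //.
  by rewrite !expr0 !mul1r invr1.
apply/is_trig_mxP => i j ij; rewrite !mxE /bcoef ifF // /shifted !partE !ffunE /=.
by have := ltn_ord j; lia.
Qed.

Lemma strip_prod (F : nat -> nat -> R) mu lam :
  \prod_(p : 'I_L * 'I_B | (lam p.1 <= p.2 < mu p.1)%N) F p.1 p.2 =
  \prod_(i < L) \prod_(lam i <= j < mu i) F i j.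
Proof.
rewrite -(pair_big_dep predT (fun (i : 'I_L) (j : 'I_B) => lam i <= j < mu i)%N
   (fun i j => F i j)) /=.
apply: eq_bigr => i _.
rewrite (big_nat_widen _ _ B) -1?ltnS // (big_nat_widenl _ 0%N) // big_mkord.
by apply: eq_bigl => j /=; rewrite andbC.
Qed.

(** The abstract rule for t = s q^(L+1). On the side of [lam] this is the parameter s q; on the side
    of [nu] both indices are raised by one, and [bcoef_shift] turns this into the parameter s. *)
Lemma sig_branching s x mu kap : is_part mu -> is_part kap ->
  \sum_(lam | interlace mu lam)
    (\prod_(p : 'I_L * 'I_B | (lam p.1 <= p.2 < mu p.1)%N) (x - s * q ^ (p.1%:Z - p.2%:Z)))
    * sig (s * q) lam kap =
  \sum_(nu | interlace nu kap) x ^+ (wsize nu - wsize kap) * sig s mu nu.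
Proof.
move=> mup kapp.
pose t := s * q ^+ L * q.
have := det_branching x (bcoef0S t) (bcoefSS t) mup kapp.
rewrite [X in _ = X -> _](_ : _ =
   \sum_(nu | interlace nu kap) x ^+ (wsize nu - wsize kap) * sig s mu nu); last first.
  apply: eq_bigr => nu _; congr (_ * \det _).
  by apply/matrixP => i j; rewrite !mxE bcoef_shift.
move=> <-; apply: eq_bigr => lam il; congr (_ * _); last first.
  by congr (\det _); apply/matrixP => i j; rewrite !mxE /t mulrAC.
rewrite (strip_prod (fun i j => x - s * q ^ (i%:Z - j%:Z))).
apply: eq_bigr => i _; rewrite /shifted !partE big_addn addnK.
apply: eq_big_nat => j _; congr (x - _).
(* The node is t / q^(a+2) at a = j + (L - i - 1), that is s q^(i - j). *)
rewrite /t -!mulrA; congr (s * _).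
rewrite -[X in _ * (X * _)]expr1z !exprnP invr_expz -!expfzDr //; congr (q ^ _).
have := ltn_ord i; lia.
Qed.

End Sig.

(** In the exponent C(M - N, 2) + (L - M)(M - N) of q, with [L] the length of [mu], the cross term M
    N cancels. Each entry is thus 1 / (q;q)_(M-N) times a row factor [a M] and a column factor
    [b N], and these supply the sign and the power of q in [sigma]. *)
Lemma sig_sigma (mu nu : intpart) : subdiagram nu mu ->
  sig 1 (rows_of (size mu) (head 0%N mu) mu) (rows_of (size mu) (head 0%N mu) nu)
  = sigma q mu nu.
Proof.
move=> sub.
have szn := subdiagram_size sub; have hdn := subdiagram_head sub.
rewrite /sig /sigma.
pose a M := (-1) ^+ M * q ^ ((M * (size mu))%:Z - 'C(M.+1, 2)%:Z).
pose b N := (-1) ^+ N * q ^ ('C(N.+1, 2)%:Z - (N * (size mu))%:Z).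
have abE M N : bcoef (1 * q ^+ (size mu)) M N = a M * inv_qpoch q (M%:Z - N%:Z) * b N.
  rewrite mul1r /bcoef; case: leqP => [NM|MN]; last first.
    have -> : (M%:Z - N%:Z)%R = Negz (N - M).-1 by lia.
    by rewrite /= mulr0 mul0r.
  have -> : (M%:Z - N%:Z)%R = Posz (M - N) by lia.
  rewrite /=; set P := (qpoch q _)^-1; rewrite [RHS]mulrAC; congr (_ * P).
  have -> : (-1) ^+ (M - N) = (-1) ^+ M * (-1) ^+ N :> R.
    by rewrite -{2}(subnK NM) exprD -mulrA -exprMn mulrNN mulr1 expr1n mulr1.
  rewrite /a /b [RHS]mulrACA -mulrA; congr (_ * _).
  rewrite !exprnP invr_expz -!expfzDr // exprz_exp -!expfzDr //; congr (q ^ _).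
  have [d Md] : exists d, (M = d + N)%N by exists (M - N)%N; rewrite subnK.
  rewrite Md addnK -addnS (bin2D d N.+1).
  move: (double_bin2 d); move: 'C(d, 2) 'C(N.+1, 2) => c1 c2 h; nia.
transitivity (\det (\matrix_(i < (size mu), j < (size mu))
   (a (shifted (rows_of (size mu) (head 0%N mu) mu) i) *
    inv_qpoch q ((shifted (rows_of (size mu) (head 0%N mu) mu) i)%:Z -
      (shifted (rows_of (size mu) (head 0%N mu) nu) j)%:Z) *
    b (shifted (rows_of (size mu) (head 0%N mu) nu) j)))).
  by congr (\det _); apply/matrixP => i j; rewrite !mxE.
rewrite det_scale; congr (_ * _); last first.
  congr (\det _); apply/matrixP => i j; rewrite !mxE /shifted !part_rows_of //.
  congr inv_qpoch; move: (ltn_ord i) (ltn_ord j); move: (nth _ mu _) (nth _ nu _) => m n.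
  by move: (size mu) (i : nat) (j : nat) => l a1 b1; lia.
rewrite -big_split /=.
(* The contributions of the translation L - i - 1 alone cancel between [a] and [b]; what is left
   sums to n(mu) - n(mu') - n(nu) + n(nu'). *)
pose z (i : nat) := (i * nth 0%N mu i)%:Z - 'C(nth 0%N mu i, 2)%:Z
  - (i * nth 0%N nu i)%:Z + 'C(nth 0%N nu i, 2)%:Z.
transitivity (\prod_(i < (size mu)) ((-1) ^+ (nth 0%N mu i + nth 0%N nu i) * q ^ z i)).
  apply: eq_bigr => i _; rewrite /a /b /shifted !part_rows_of // mulrACA.
  congr (_ * _).
    by rewrite !exprD mulrACA -[X in _ * X = _]exprMn mulrNN mulr1 expr1n mulr1.
  rewrite -expfzDr //; congr (q ^ _); rewrite /z.
  set m := nth _ _ _; set n := nth _ _ _.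
  have Li : ((size mu) = ((size mu) - i.+1) + i + 1)%N by have := ltn_ord i; lia.
  move: ((size mu) - i.+1)%N Li => e; move: (size mu) (nat_of_ord i) => l i' ->.
  rewrite -!addnS !(bin2D _ e.+1); move: 'C(m, 2) 'C(n, 2) 'C(e.+1, 2) => c1 c2 c3; nia.
rewrite big_split /= prodrXr; congr (_ * _).
  rewrite big_split /= -(big_mkord predT (nth 0%N mu)) -(big_mkord predT (nth 0%N nu)).
  have sz (ka : intpart) : (size ka <= (size mu))%N ->
      (\sum_(0 <= i < (size mu)) nth 0 ka i = sumn ka)%N.
    move=> le; rewrite (sumn_truncate le) => [|i ?]; last by rewrite nth_default.
    by rewrite sumnE [RHS](big_nth 0%N).
  rewrite !sz // expfzDr ?oppr_eq0 ?oner_eq0 // -invr_expz -!exprnP exprD.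
  by rewrite -[in RHS]exprVn invrN1.
have -> : \prod_(i < (size mu)) q ^ z i = q ^ (\sum_(i < (size mu)) z i).
  by rewrite (big_morph (fun z => q ^ z) (fun x y => expfzDr x y q0) (expr0z q)).
congr (q ^ _); rewrite /z !big_split /= !sumrN.
rewrite (n_stat_wide (leqnn (size mu))) (n_stat_wide szn).
rewrite (n_stat_transpose (leqnn (size mu))) (n_stat_transpose szn).
by rewrite !big_mkord !(big_morph Posz PoszD (erefl _)).
Qed.

End Coefficients.

(** * Chains of horizontal strips and their commutation *)

Lemma foldr_perm (I : eqType) X (f : I -> X -> X) (x : X) (s1 s2 : seq I) :
  (forall a b y, f a (f b y) = f b (f a y)) -> perm_eq s1 s2 ->
  foldr f x s1 = foldr f x s2.
Proof.
move=> fC; elim: s1 s2 => [|a s1 IH] s2; first by move/perm_size/esym/size0nil ->.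
move=> p; have as2 : a \in s2 by rewrite -(perm_mem p) mem_head.
case/splitPr: s2 / as2 p => p1 p2 p.
have {}p : perm_eq s1 (p1 ++ p2).
  by move: p; rewrite perm_sym -[a :: p2]cat1s perm_catCA /= perm_cons perm_sym.
rewrite /= (IH _ p) !foldr_cat /=.
by elim: p1 {p} => //= b p1 <-; rewrite fC.
Qed.

Section Chains.
Variables (L B : nat) (A : comNzRingType).
Implicit Types (mu nu lam kap rho : rows L B) (phi : rows L B -> A).

Definition step (w : rows L B -> rows L B -> A) phi mu : A :=
  \sum_(lam | interlace mu lam) w mu lam * phi lam.

(** A weighted sum over sequences of [n] successive horizontal strips removed from the argument,
    with end function [phi]. Schur polynomials, tableau sums and the iterated branching rule all
    take this form. *)
Fixpoint chain n (w : nat -> rows L B -> rows L B -> A) phi : rows L B -> A :=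
  if n is n'.+1 then step (w 0%N) (chain n' (fun k => w k.+1) phi) else phi.

Lemma chain_foldr n w phi : chain n w phi = foldr (fun k => step (w k)) phi (iota 0 n).
Proof.
elim: n w => //= n IH w; rewrite IH -[1%N]add1n iotaDl; congr step.
by elim: (iota 0 n) => //= a s ->.
Qed.

Definition delta0 mu : A := (mu == [ffun=> ord0])%:R.

Definition wdiff (v : nat -> A) mu lam : A := v (wsize mu - wsize lam)%N.

Let lo mu rho i := maxn (part mu i.+1) (part rho i).
Let hi mu rho i := minn (part mu i) (above rho i).

Lemma interlace2 mu kap rho : interlace mu kap && interlace kap rho =
  [forall i : 'I_L, lo mu rho i <= kap i <= hi mu rho i]%N.
Proof.
rewrite (interlace_above kap) /interlace.
apply/andP/forallP => [[/forallP h1 /forallP h2] i|h].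
  by have := h1 i; have := h2 i; rewrite /lo /hi !partE; lia.
by split; apply/forallP => i; have := h i; rewrite /lo /hi !partE; lia.
Qed.

(** The lower end of row i pairs with the upper end of row i + 1: they are the maximum and the
    minimum of the same two numbers [part mu i.+1] and [part rho i]. *)
Lemma lo_hi_sum mu rho :
  (\sum_(0 <= i < L) (lo mu rho i + hi mu rho i) = wsize mu + wsize rho)%N.
Proof.
rewrite !wsizeE.
suff aux n : L = n -> (\sum_(0 <= i < n) (lo mu rho i + hi mu rho i) =
   \sum_(0 <= i < n) part mu i + \sum_(0 <= i < n) part rho i)%N by exact: aux.
case: n => [|l] Ll; first by rewrite !big_geq.
rewrite big_split /= big_nat_recr //= [X in (_ + X)%N]big_nat_recl //.
rewrite [X in (X + _)%N = _]addnC -addnA [X in (_ + X)%N = _]addnCA -big_split /=.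
rewrite [X in _ = (X + _)%N]big_nat_recl // [X in _ = (_ + X)%N]big_nat_recr //=.
have -> : lo mu rho l = part rho l by rewrite /lo part_default ?max0n // Ll.
have -> : hi mu rho 0 = part mu 0 by rewrite /hi /above; apply/minn_idPl; exact: part_le.
have -> : (\sum_(0 <= i < l) (lo mu rho i + hi mu rho i.+1) =
   \sum_(0 <= i < l) part mu i.+1 + \sum_(0 <= i < l) part rho i)%N.
  by rewrite -big_split /=; apply: eq_bigr => i _; rewrite /lo /hi /above /=; lia.
lia.
Qed.

(* The Bender-Knuth involution: [kap i] is reflected in the interval
   to which interlacing with [mu] and [rho] confines it. *)
Definition flip mu rho kap : rows L B :=
  [ffun i : 'I_L => inord (lo mu rho i + hi mu rho i - kap i)].

Lemma flip_val mu rho kap (i : 'I_L) : interlace mu kap && interlace kap rho ->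
  flip mu rho kap i = (lo mu rho i + hi mu rho i - kap i)%N :> nat.
Proof.
rewrite interlace2 => /forallP/(_ i) h; rewrite ffunE inordK // ltnS.
have : (hi mu rho i <= B)%N by rewrite /hi geq_min part_le.
move: h; lia.
Qed.

Lemma flip_interlace mu rho kap : interlace mu kap && interlace kap rho ->
  interlace mu (flip mu rho kap) && interlace (flip mu rho kap) rho.
Proof.
move=> h; rewrite interlace2; apply/forallP => i; rewrite flip_val //.
by move: h; rewrite interlace2 => /forallP/(_ i); lia.
Qed.

Lemma flipK mu rho kap : interlace mu kap && interlace kap rho ->
  flip mu rho (flip mu rho kap) = kap.
Proof.
move=> h; apply/ffunP => i; apply: val_inj.
rewrite /= flip_val ?flip_interlace // flip_val //.
by move: h; rewrite interlace2 => /forallP/(_ i); lia.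
Qed.

Lemma wsize_flip mu rho kap : interlace mu kap && interlace kap rho ->
  (wsize (flip mu rho kap) + wsize kap = wsize mu + wsize rho)%N.
Proof.
move=> h; rewrite -(lo_hi_sum mu rho) big_mkord /wsize -big_split /=.
apply: eq_bigr => i _; rewrite /= flip_val //.
by move: h; rewrite interlace2 => /forallP/(_ i); lia.
Qed.

(** By [wsize_flip], reflecting the middle shape exchanges the sizes of the two strips, so swapping
    the weights is a reindexing of the sum. *)
Lemma step_comm v1 v2 phi :
  step (wdiff v1) (step (wdiff v2) phi) = step (wdiff v2) (step (wdiff v1) phi).
Proof.
have expand u1 u2 mu : step (wdiff u1) (step (wdiff u2) phi) mu =
  \sum_rho \sum_(kap | interlace mu kap && interlace kap rho)
    (u1 (wsize mu - wsize kap)%N * u2 (wsize kap - wsize rho)%N * phi rho).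
  rewrite /step; under eq_bigr do rewrite big_distrr /=.
  rewrite (exchange_big_dep predT) //=; apply: eq_bigr => rho _.
  by apply: eq_bigr => kap _; rewrite mulrA.
apply/funext => mu; rewrite !expand; apply: eq_bigr => rho _.
rewrite (reindex_onto (flip mu rho) (flip mu rho)); last by move=> kap; exact: flipK.
apply: eq_big => [kap|kap /andP[h1 /eqP h2]].
  apply/andP/idP => [[h /eqP e]|h]; first by rewrite -e; exact: flip_interlace.
  by rewrite flip_interlace // flipK.
have h : interlace mu kap && interlace kap rho by rewrite -h2; exact: flip_interlace.
have := wsize_flip h; have /andP[/interlace_wsize i1 /interlace_wsize i2] := h.
have /andP[/interlace_wsize i3 /interlace_wsize i4] := h1.
move=> e; rewrite [u in u * _]mulrC; congr (v2 _ * v1 _ * _); lia.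
Qed.

Definition on_parts phi := forall mu, ~~ is_part mu -> phi mu = 0.

Lemma on_parts_step w phi : on_parts (step w phi).
Proof.
move=> mu h; apply: big_pred0 => lam; apply: contraNF h; exact: interlace_part1.
Qed.

Lemma on_parts_delta0 : on_parts delta0.
Proof.
move=> mu; rewrite /delta0; case: eqP => // -> /negP[].
by apply/forallP => i; rewrite ffunE /part; case: insubP => //= j _ _; rewrite ffunE.
Qed.

Lemma wsize_inj_le mu lam : (forall i, lam i <= mu i)%N -> wsize lam = wsize mu -> lam = mu.
Proof.
move=> le /eqP; rewrite /wsize => e; apply/ffunP => i; apply/val_inj/eqP => /=.
have := @leqif_sum _ predT (fun i => lam i == mu i) (fun i => lam i : nat) (fun i => mu i : nat)
  (fun i _ => leqif_eq (le i)).
by case=> _; rewrite e => /esym/forallP/(_ i).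
Qed.

(** The only strip of size 0 is the empty one. The support condition enters because [step] yields 0
    outside partitions. *)
Lemma step_wdiff0 phi : on_parts phi -> step (wdiff (fun d => (d == 0%N)%:R)) phi = phi.
Proof.
move=> hphi; apply/funext => mu; case: (boolP (is_part mu)) => mup; last first.
  by rewrite hphi // on_parts_step.
have mm : interlace mu mu by apply/forallP => i; have /forallP/(_ i) -> := mup; rewrite leqnn.
rewrite /step (bigD1 mu) //= /wdiff subnn eqxx mul1r big1 ?addr0 // => lam /andP[il ne].
rewrite subn_eq0 [(_ <= _)%N](_ : _ = false) ?mul0r //.
apply: contraNF ne => le; apply/eqP/wsize_inj_le.
  by move=> i; have := interlace_le i il; rewrite !partE.
by apply/eqP; rewrite eqn_leq le interlace_wsize.
Qed.

Lemma chain_perm (v : nat -> nat -> A) (s1 s2 : seq nat) : perm_eq s1 s2 ->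
  foldr (fun k => step (wdiff (v k))) delta0 s1 =
  foldr (fun k => step (wdiff (v k))) delta0 s2.
Proof. by apply: foldr_perm => a b y; exact: step_comm. Qed.

(** Allows chains over different finite ranges of variables to be compared through their nonzero
    exponents. *)
Lemma chain_filter (e : nat -> nat) (s : seq nat) :
  foldr (fun k => step (wdiff (fun d => (d == e k)%:R))) delta0 s =
  foldr (fun k => step (wdiff (fun d => (d == e k)%:R))) delta0 [seq k <- s | e k != 0%N].
Proof.
elim: s => //= k s IH; case: eqP => [->|_] /=; last by rewrite IH.
rewrite step_wdiff0 //; case: s {IH} => [|k' s] /=; last exact: on_parts_step.
exact: on_parts_delta0.
Qed.

End Chains.

(** * Reverse tableaux as chains of strips *)

Section Tableaux.
Variables (L B : nat).
Implicit Types (mu nu lam : rows L B).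

Lemma card_ltn_ord n m : (m <= n)%N -> #|[pred k : 'I_n | k < m]%N| = m.
Proof.
move=> mn; rewrite -sum1_card.
by rewrite -(big_ord_widen n (fun=> 1%N) mn) sum1_card card_ord.
Qed.

Lemma downclosed_card n (P : pred 'I_n) :
  (forall j j' : 'I_n, (j <= j')%N -> P j' -> P j) ->
  forall j : 'I_n, (j < #|P|)%N = P j.
Proof.
move=> h j; case: (boolP (P j)) => Pj.
  apply: (@leq_trans #|[pred k : 'I_n | k < j.+1]%N|); first by rewrite card_ltn_ord.
  by apply/subset_leq_card/fintype.subsetP => k; rewrite !inE ltnS => /h; apply.
apply/negbTE; rewrite -leqNgt.
apply: (@leq_trans #|[pred k : 'I_n | k < j]%N|); last by rewrite card_ltn_ord // ltnW.
apply/subset_leq_card/fintype.subsetP => k; rewrite !inE => Pk.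
by rewrite ltnNge; apply: contra Pj => /h; apply.
Qed.

Lemma rows_eq lam mu :
  (forall (i : 'I_L) (j : 'I_B), (j < lam i)%N = (j < mu i)%N) -> lam = mu.
Proof.
move=> h; apply/ffunP => i; apply/val_inj/eqP => /=.
rewrite eqn_leq; apply/andP; split; rewrite leqNgt; apply/negP => lt.
  have jB : (mu i < B)%N by apply: leq_trans lt _; rewrite -ltnS.
  by have := h i (Ordinal jB); rewrite /= lt ltnn.
have jB : (lam i < B)%N by apply: leq_trans lt _; rewrite -ltnS.
by have := h i (Ordinal jB); rewrite /= lt ltnn.
Qed.

Definition grid n := {ffun 'I_L * 'I_B -> 'I_n.+1}.

(* A reverse tableau of shape [mu] with entries at most [n], extended by [0]
   outside [mu]. *)
Definition rtab n mu (f : grid n) : bool :=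
  [&& [forall i : 'I_L, forall j : 'I_B, (0 < f (i, j)) == (j < mu i)],
      [forall i : 'I_L, forall j : 'I_B, forall j' : 'I_B, (j <= j') ==> (f (i, j') <= f (i, j))] &
      [forall i : 'I_L, forall i' : 'I_L, forall j, (i < i') ==> (f (i', j) <= (f (i, j)).-1)]]%N.

(** Strictness down columns is expressed with a predecessor, so that zeros may stand below zeros
    outside the shape. *)
Lemma rtabP n mu (f : grid n) : reflect
  [/\ forall (i : 'I_L) (j : 'I_B), (0 < f (i, j))%N = (j < mu i)%N,
      forall (i : 'I_L) (j j' : 'I_B), (j <= j')%N -> (f (i, j') <= f (i, j))%N &
      forall (i i' : 'I_L) (j : 'I_B), (i < i')%N -> (f (i', j) <= (f (i, j)).-1)%N]
  (rtab mu f).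
Proof.
apply: (iffP and3P) => [[h1 h2 h3]|[h1 h2 h3]]; split.
- by move=> i j; move/forallP/(_ i)/forallP/(_ j)/eqP: h1.
- by move=> i j j' jj; move/forallP/(_ i)/forallP/(_ j)/forallP/(_ j'): h2; rewrite jj.
- by move=> i i' j ii; move/forallP/(_ i)/forallP/(_ i')/forallP/(_ j): h3; rewrite ii.
- by apply/forallP => i; apply/forallP => j; rewrite h1.
- by do 3!apply/forallP => ?; apply/implyP; exact: h2.
- by do 3!apply/forallP => ?; apply/implyP; exact: h3.
Qed.

(** Truncated subtraction removes the entries 1 and lowers the others at once. [inner] is the shape
    that remains, and [glift mu] refills the shape [mu]. *)
Definition gpred n (f : grid n.+1) : grid n := [ffun p => inord (f p).-1].
Definition glift n mu (f : grid n) : grid n.+1 :=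
  [ffun p : 'I_L * 'I_B => inord (f p + (p.2 < mu p.1))].
Definition inner n (f : grid n) : rows L B :=
  [ffun i : 'I_L => inord #|[pred j : 'I_B | 1 < f (i, j)]%N|].

Lemma gpredE n (f : grid n.+1) p : gpred f p = (f p).-1 :> nat.
Proof. by rewrite ffunE inordK //; have := ltn_ord (f p); lia. Qed.

Lemma gliftE n mu (f : grid n) (p : 'I_L * 'I_B) :
  glift mu f p = (f p + (p.2 < mu p.1))%N :> nat.
Proof. by rewrite ffunE inordK //; have := ltn_ord (f p); lia. Qed.

Lemma innerE n mu (f : grid n) (i : 'I_L) (j : 'I_B) : rtab mu f ->
  (j < inner f i)%N = (1 < f (i, j))%N.
Proof.
move=> /rtabP[_ h _]; rewrite ffunE inordK; last first.
  by rewrite ltnS -[X in (_ <= X)%N]card_ord max_card.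
rewrite downclosed_card // => j1 j2 le /= h2; exact: leq_trans h2 (h i j1 j2 le).
Qed.

Lemma glift_pred n mu (f : grid n.+1) : rtab mu f -> glift mu (gpred f) = f.
Proof.
move=> /rtabP[h _ _]; apply/ffunP => -[i j]; apply: val_inj.
rewrite /= gliftE gpredE /= -h; by case: (nat_of_ord (f (i, j))) => //= m; rewrite addn1.
Qed.

Lemma rtab_pred n mu (f : grid n.+1) : rtab mu f -> rtab (inner f) (gpred f).
Proof.
move=> hf; have /rtabP[h1 h2 h3] := hf; apply/rtabP; split.
- by move=> i j; rewrite gpredE (innerE _ _ hf); lia.
- by move=> i j j' /h2 h; rewrite !gpredE; have := h i; lia.
- by move=> i i' j /h3 h; rewrite !gpredE; have := h j; lia.
Qed.

(** A box lying above another box of [mu] holds an entry at least 2 and survives; hence the boxes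
    with entry 1 form a horizontal strip. *)
Lemma rtab_interlace n mu (f : grid n) : rtab mu f -> interlace mu (inner f).
Proof.
move=> hf; have /rtabP[h1 h2 h3] := hf; apply/forallP => i; apply/andP; split.
  case: (ltnP i.+1 L) => [iL|]; last by move/part_default ->.
  rewrite (partE _ (Ordinal iL)) leqNgt; apply/negP => lt.
  have jB : (inner f i < B)%N by apply: leq_trans lt _; rewrite -ltnS.
  have : (0 < f (Ordinal iL, Ordinal jB))%N by rewrite h1.
  have := h3 i (Ordinal iL) (Ordinal jB) (leqnn _).
  by have := innerE i (Ordinal jB) hf; rewrite /= ltnn; lia.
rewrite leqNgt; apply/negP => lt.
have jB : (mu i < B)%N by apply: leq_trans lt _; rewrite -ltnS.
have := innerE i (Ordinal jB) hf; have := h1 i (Ordinal jB); rewrite /= lt ltnn; lia.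
Qed.

Lemma gpredK n mu (f : grid n) lam : interlace mu lam -> rtab lam f -> gpred (glift mu f) = f.
Proof.
move=> il /rtabP[h _ _]; apply/ffunP => -[i j]; apply: val_inj.
rewrite /= gpredE gliftE /=; have := h i j; have := interlace_le i il; rewrite !partE.
lia.
Qed.

Lemma rtab_lift n mu lam (f : grid n) : interlace mu lam -> rtab lam f -> rtab mu (glift mu f).
Proof.
move=> il /rtabP[h1 h2 h3]; have mup := interlace_part1 il; apply/rtabP; split.
- move=> i j; rewrite gliftE /=; have := h1 i j; have := interlace_le i il; rewrite !partE; lia.
- by move=> i j j' jj; rewrite !gliftE /=; have := h2 i j j' jj; lia.
- move=> i i' j ii; rewrite !gliftE /=; have := h3 i i' j ii; have := h1 i j; have := h1 i' j.
  have := part_anti mup ii; have /interlaceP/(_ i)/andP[] := il; rewrite !partE; lia.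
Qed.

Lemma inner_lift n mu lam (f : grid n) : interlace mu lam -> rtab lam f ->
  inner (glift mu f) = lam.
Proof.
move=> il hf; apply: rows_eq => i j; rewrite (innerE _ _ (rtab_lift il hf)) gliftE /=.
move/rtabP: hf => [/(_ i j) h _ _]; have := interlace_le i il; rewrite !partE; lia.
Qed.

Lemma rtab_recursion (A : nmodType) n mu (Phi : grid n.+1 -> A) :
  \sum_(f | rtab mu f) Phi f =
  \sum_(lam | interlace mu lam) \sum_(f | rtab lam f) Phi (glift mu f).
Proof.
rewrite (partition_big (@inner n.+1) (interlace mu)) /=; last first.
  by move=> f; exact: rtab_interlace.
apply: eq_bigr => lam il.
rewrite (reindex_onto (glift mu) (@gpred n)) /=; last first.
  by move=> f /andP[/glift_pred].
apply: eq_bigl => f; apply/idP/idP => [/andP[/andP[h /eqP <-] /eqP e]|h].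
  by have := rtab_pred h; rewrite e.
by rewrite (rtab_lift il h) (inner_lift il h) (gpredK il h) !eqxx.
Qed.

Lemma rtab0 mu (f : grid 0) : rtab mu f = (mu == [ffun=> ord0]).
Proof.
have f0 p : f p = 0%N :> nat by have := ltn_ord (f p); lia.
apply/rtabP/eqP => [[h _ _]|->].
  by apply: rows_eq => i j; rewrite -h f0 ffunE.
by split=> [i j|i j j' _|i i' j _]; rewrite !f0 ?ffunE.
Qed.

Section Weights.
Variable A : comNzRingType.

Definition wstrip (g : nat -> 'I_L * 'I_B -> A) (k : nat) mu lam : A :=
  \prod_(p : 'I_L * 'I_B | (lam p.1 <= p.2 < mu p.1)%N) g k p.

(** The entries 1 form the first strip, weighted by [g 0]; the others are the entries of the inner
    tableau raised by 1, which shifts [g] as [chain] does. *)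
Lemma rtab_prod n mu (g : nat -> 'I_L * 'I_B -> A) :
  \sum_(f : grid n | rtab mu f) \prod_(p : 'I_L * 'I_B | (p.2 < mu p.1)%N) g (f p).-1 p =
  chain n (wstrip g) (@delta0 L B A) mu.
Proof.
elim: n mu g => [|n IH] mu g /=.
  under eq_bigl do rewrite rtab0.
  rewrite /delta0; case: eqP => [->|_]; last by rewrite big_pred0.
  have h0 (f : grid 0) : f = [ffun=> ord0].
    by apply/ffunP => p; rewrite ffunE; exact: ord1.
  rewrite (big_pred1 [ffun=> ord0]) => [|f]; last by rewrite (h0 f) /= eqxx.
  by rewrite big_pred0 // => p; rewrite ffunE.
rewrite rtab_recursion; apply: eq_bigr => lam il.
rewrite -IH big_distrr /=; apply: eq_bigr => f /rtabP[h _ _].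
have le (i : 'I_L) : ((lam : rows L B) i <= mu i)%N by have := interlace_le i il; rewrite !partE.
rewrite (bigID (fun p : 'I_L * 'I_B => p.2 < lam p.1)%N) /= mulrC; congr (_ * _).
  apply: eq_big => [[i j]|[i j]] /=; first by rewrite -leqNgt andbC.
  move=> /andP[h1 h2]; rewrite gliftE /= h1; have := h i j; rewrite (negbTE h2).
  by move=> /negbT; rewrite -eqn0Ngt => /eqP ->.
apply: eq_big => [[i j]|[i j]] /=; first by apply: andb_idl => h1; exact: leq_trans h1 (le i).
by move=> /andP[h1 h2]; rewrite gliftE /= h1; have := h i j; rewrite h2 addn1 => /prednK ->.
Qed.

Lemma wsize_card mu : #|[pred p : 'I_L * 'I_B | p.2 < mu p.1]%N| = wsize mu.
Proof.
rewrite -sum1_card -(pair_big_dep predT (fun (i : 'I_L) (j : 'I_B) => (j < mu i)%N)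
   (fun _ _ => 1%N)) /=.
by apply: eq_bigr => i _; rewrite sum1_card card_ltn_ord // -ltnS.
Qed.

Lemma strip_card mu lam : interlace mu lam ->
  #|[pred p : 'I_L * 'I_B | lam p.1 <= p.2 < mu p.1]%N| = (wsize mu - wsize lam)%N.
Proof.
move=> il; rewrite -!wsize_card -(cardID [pred p : 'I_L * 'I_B | p.2 < lam p.1]%N
  [pred p : 'I_L * 'I_B | p.2 < mu p.1]%N).
rewrite [X in (X + _ - _)%N](_ : _ = #|[pred p : 'I_L * 'I_B | p.2 < lam p.1]%N|).
  rewrite addKn; apply: eq_card => p; rewrite !inE; lia.
apply: eq_card => -[i j]; rewrite !inE /=.
have := interlace_le i il; rewrite !partE; lia.
Qed.

Lemma wstrip_cst (x : nat -> A) k mu lam : interlace mu lam ->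
  wstrip (fun k _ => x k) k mu lam = wdiff (fun d => x k ^+ d) mu lam.
Proof. by move=> il; rewrite /wstrip prodr_const strip_card. Qed.

(** The same peeling: the number of entries k + 1 is the size of the strip removed at step [k]. *)
Lemma rtab_count n mu (e : nat -> nat) :
  \sum_(f : grid n | rtab mu f)
     \prod_(k < n) (#|[pred p | f p == k.+1 :> nat]| == e k)%:R =
  chain n (fun k => wdiff (fun d => (d == e k)%:R)) (@delta0 L B A) mu.
Proof.
elim: n mu e => [|n IH] mu e /=.
  under eq_bigl do rewrite rtab0.
  rewrite /delta0; case: eqP => _; last by rewrite big_pred0.
  have h0 (f : grid 0) : f = [ffun=> ord0].
    by apply/ffunP => p; rewrite ffunE; exact: ord1.
  rewrite (big_pred1 [ffun=> ord0]) => [|f]; last by rewrite (h0 f) /= eqxx.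
  by rewrite big_ord0.
rewrite rtab_recursion; apply: eq_bigr => lam il.
rewrite -IH big_distrr /=; apply: eq_bigr => f /rtabP[h _ _].
have le (i : 'I_L) : ((lam : rows L B) i <= mu i)%N by have := interlace_le i il; rewrite !partE.
rewrite big_ord_recl; congr (_ * _).
  rewrite /wdiff -strip_card //; congr (_ == _)%:R.
  suff key (i : 'I_L) (j : 'I_B) : (glift mu f (i, j) == 1%N :> nat) = (lam i <= j < mu i)%N.
    by apply: eq_card => -[i j]; exact: key.
  by rewrite gliftE /=; have := h i j; have := le i; lia.
apply: eq_bigr => k _; congr (_ == _)%:R.
suff key (i : 'I_L) (j : 'I_B) :
    (glift mu f (i, j) == (bump 0 k).+1 :> nat) = (f (i, j) == k.+1 :> nat).
  by apply: eq_card => -[i j]; exact: key.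
rewrite gliftE /bump /=; have := h i j; have := le i; lia.
Qed.

End Weights.
End Tableaux.

(** * Norm estimates for chains *)

Section ChainBound.
Variables (R : realType) (L B : nat).
Implicit Types (mu lam : rows L B).

Lemma geometric_le (y : R) m : 0 <= y -> \sum_(0 <= d < m.+1) y ^+ d <= (1 + y) ^+ m.
Proof.
move=> y0; elim: m => [|m IH]; first by rewrite big_nat1 !expr0.
rewrite big_nat_recl // expr0.
under eq_bigr do rewrite exprS.
rewrite -mulr_sumr exprS mulrDl mul1r lerD ?ler_wpM2l //.
by rewrite exprn_ege1 // lerDl.
Qed.

(** Forgetting the lower bounds of interlacing leaves a product of one geometric sum per row, each
    at most (1 + y)^(mu_i). *)
Lemma strip_sum_le (y : R) mu : 0 <= y ->
  \sum_(lam | interlace mu lam) y ^+ (wsize mu - wsize lam) <= (1 + y) ^+ wsize mu.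
Proof.
move=> y0.
pose Q (i : 'I_L) := fun v : 'I_B.+1 => (v <= mu i)%N.
apply: (@le_trans _ _ (\prod_(i < L) \sum_(v | Q i v) y ^+ (mu i - v))).
  rewrite bigA_distr_big_dep big_mkcond [leRHS]big_mkcond; apply: ler_sum => lam _.
  case: ifPn => [il|_]; last by case: ifP => // _; rewrite prodr_ge0 // => i _; rewrite exprn_ge0.
  have le (i : 'I_L) : ((lam : rows L B) i <= mu i)%N by have := interlace_le i il; rewrite !partE.
  rewrite (_ : lam \in family Q); last by apply/familyP => i; exact: le.
  by rewrite prodrXr /wsize -sumnB.
rewrite /wsize expr_sum; apply: ler_prod => i _.
apply/andP; split; first by rewrite sumr_ge0 // => v _; rewrite exprn_ge0.
rewrite (le_trans _ (geometric_le _ y0)) //.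
rewrite big_nat_rev /= add0n (eq_big_nat _ _ (F2 := fun v => y ^+ (mu i - v))); last first.
  by move=> v _; rewrite subSS.
by rewrite (big_nat_widen _ _ B.+1) // big_mkord.
Qed.

(** Sizes decrease along a chain, so step [k] costs at most a factor (1 + y k)^|mu|. *)
Lemma chain_bound n (w : nat -> rows L B -> rows L B -> R) (phi : rows L B -> R)
    (y : nat -> R) (C : R) mu :
  (forall k, 0 <= y k) -> 0 <= C ->
  (forall k nu lam, interlace nu lam -> `|w k nu lam| <= y k ^+ (wsize nu - wsize lam)) ->
  (forall lam, `|phi lam| <= C) ->
  `|chain n w phi mu| <= C * (\prod_(0 <= k < n) (1 + y k)) ^+ wsize mu.
Proof.
move=> y0 C0 + hphi; elim: n w y y0 mu => [|n IH] w y y0 mu hw /=.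
  by rewrite big_geq // expr1n mulr1.
set P := \prod_(0 <= k < n) (1 + y k.+1).
have P1 : 1 <= P.
  rewrite /P big_nat; elim/big_ind: _ => // [a b a1 b1|k _]; last by rewrite lerDl.
  by rewrite -[1]mulr1 ler_pM.
rewrite big_nat_recl // -/P exprMn.
apply: le_trans (ler_norm_sum _ _ _) _.
apply: (@le_trans _ _ (\sum_(lam | interlace mu lam)
    y 0%N ^+ (wsize mu - wsize lam) * (C * P ^+ wsize mu))).
  apply: ler_sum => lam il; rewrite normrM ler_pM ?hw //.
  apply: le_trans (IH _ (fun k => y k.+1) _ _ _) _ => //.
  - by move=> k nu ka h; exact: hw.
  - by rewrite ler_wpM2l // ler_weXn2l // interlace_wsize.
rewrite -mulr_suml [leRHS]mulrCA ler_wpM2r ?strip_sum_le //.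
by rewrite mulr_ge0 // exprn_ge0 // (le_trans _ P1).
Qed.

End ChainBound.

(** * Absolutely convergent sums as limits of finite sums *)

Section Exhaustion.
Variables (R : realType) (T : choiceType) (D : set T).
Implicit Types (f g : T -> R) (s : nat -> seq T).

(** Only the support of [f] has to be reached, so that monomials of too large degree can be left
    out. *)
Definition exhausts f s :=
  [/\ forall n, uniq (s n),
      forall n t, t \in s n -> D t &
      forall t, D t -> f t != 0 -> exists N, forall n, (N <= n)%N -> t \in s n].

Lemma sum_subseq_le g (s1 s2 : seq T) : (forall t, 0 <= g t) -> uniq s1 -> uniq s2 ->
  (forall t, t \in s1 -> g t != 0 -> t \in s2) ->
  \sum_(t <- s1) g t <= \sum_(t <- s2) g t.
Proof.
move=> g0 u1 u2 sub; rewrite [leRHS](bigID (mem s1)) /=.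
have -> : \sum_(t <- s1) g t = \sum_(t <- s2 | t \in s1) g t.
  rewrite (bigID (mem s2)) /= [X in _ + X]big1_seq ?addr0; last first.
    move=> t /andP[ns2 s1t]; apply/eqP; apply: contraNT ns2; exact: sub.
  rewrite -big_filter -[RHS]big_filter; apply/perm_big/uniq_perm; rewrite ?filter_uniq // => t.
  by rewrite !mem_filter andbC.
by rewrite lerDl sumr_ge0.
Qed.

Lemma exhausts_finite f s (F : seq T) : exhausts f s ->
  (forall t, t \in F -> D t) ->
  exists N, forall n, (N <= n)%N -> forall t, t \in F -> f t != 0 -> t \in s n.
Proof.
move=> [_ _ ex]; elim: F => [|a F IH] FD; first by exists 0%N.
have [N1 h1] := IH (fun t tF => FD t (@mem_behead _ (a :: F) t tF)).
have [f0|f0] := eqVneq (f a) 0.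
  exists N1 => n le t; rewrite inE => /predU1P[->|tF]; first by rewrite f0 eqxx.
  exact: h1.
have [N2 h2] := ex a (FD a (mem_head _ _)) f0.
exists (maxn N1 N2) => n; rewrite geq_max => /andP[le1 le2] t.
by rewrite inE => /predU1P[-> _|tF]; [exact: h2|exact: h1].
Qed.

Lemma exhausts_finite_le f s g (A : set T) : exhausts f s ->
  (forall t, 0 <= g t) -> (forall t, g t != 0 -> f t != 0) -> fsets D A ->
  exists N, forall n, (N <= n)%N ->
    (\sum_(t \in A) (g t)%:E <= (\sum_(t <- s n) g t)%:E)%E.
Proof.
move=> es g0 gf [/finite_fsetP[F ->] FD].
have [N h] := exhausts_finite es (fun t (tF : t \in (F : seq T)) => FD t tF).
exists N => n /h le; rewrite -fsbig_seq ?fset_uniq // sumEFin lee_fin.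
by apply: sum_subseq_le => //; [case: es|move=> t tF /gf; exact: le].
Qed.

Lemma exhausts_summable f s C : exhausts f s ->
  (forall n, \sum_(t <- s n) `|f t| <= C) -> summable D (EFin \o f).
Proof.
move=> es hC; rewrite /summable; apply: (@le_lt_trans _ _ C%:E); last exact: ltry.
apply: ge_ereal_sup => _ [A hA <-] /=.
have [||N h] := @exhausts_finite_le f s (fun t => `|f t|) A es _ _ hA => //.
  by move=> t; rewrite normr_eq0.
apply: le_trans (h N (leqnn _)) _; rewrite lee_fin; exact: hC.
Qed.

(** The partial sums stay below the supremum and eventually exceed every finite sum that
    approximates it. *)
Lemma exhausts_cvg_ge0 f s g : exhausts f s ->
  (forall t, 0 <= g t) -> (forall t, g t != 0 -> f t != 0) ->
  (\esum_(t in D) (g t)%:E < +oo)%E ->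
  (\sum_(t <- s n) g t) @[n --> \oo] --> fine (\esum_(t in D) (g t)%:E)%E.
Proof.
move=> es g0 gf fin.
have ge0 : (0 <= \esum_(t in D) (g t)%:E)%E by apply: esum_ge0 => t _; rewrite lee_fin.
have fn : (\esum_(t in D) (g t)%:E \is a fin_num)%E by rewrite ge0_fin_numE.
have [us sD _] := es.
have up n : \sum_(t <- s n) g t <= fine (\esum_(t in D) (g t)%:E)%E.
  rewrite -lee_fin fineK // -sumEFin fsbig_seq //.
  apply: ereal_sup_ubound; exists [set` s n] => //; split; first exact: finite_seq.
  by move=> t; exact: sD.
apply/cvgrPdist_le => e e0.
have [_ [A hA <-] lt] := ub_ereal_sup_adherent e0 fn.
have [N h] := exhausts_finite_le es g0 gf hA.
exists N => // n /= Nn; rewrite ger0_norm ?subr_ge0 //.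
rewrite lerBlDr -lerBlDl -lee_fin; apply: le_trans (h n Nn).
by rewrite EFinB fineK //; exact: ltW.
Qed.

(** Applied to the positive and negative parts separately; this reduces an identity between values
    of [abs_sum] to a comparison of truncations. *)
Lemma exhausts_cvg f s : exhausts f s -> summable D (EFin \o f) ->
  (\sum_(t <- s n) f t) @[n --> \oo] --> abs_sum D f.
Proof.
move=> es sm.
pose gp t := Num.max (f t) 0; pose gn t := Num.max (- f t) 0.
have fE t : f t = gp t - gn t.
  rewrite /gp /gn; have [h|/ltW h] := leP (f t) 0.
    by rewrite max_l ?oppr_ge0 // sub0r opprK.
  by rewrite max_r ?oppr_le0 // subr0.
have gpE : (EFin \o f)^\+%E = (fun t => (gp t)%:E).
  by apply/funext => t; rewrite funeposE /= EFin_max.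
have gnE : (EFin \o f)^\-%E = (fun t => (gn t)%:E).
  by apply/funext => t; rewrite funenegE /= EFin_max.
have lt g : (forall t, g t <= `|f t|) -> (\esum_(t in D) (g t)%:E < +oo)%E.
  by move=> gf; apply: le_lt_trans sm; apply: le_esum => t _; rewrite lee_fin.
rewrite /abs_sum gpE gnE.
have -> : (fun n => \sum_(t <- s n) f t) =
    (fun n => \sum_(t <- s n) gp t - \sum_(t <- s n) gn t).
  by apply/funext => n; rewrite -sumrB; apply: eq_bigr => t _; exact: fE.
apply: cvgB; apply: (exhausts_cvg_ge0 es).
- by move=> t; rewrite /gp le_max lexx orbT.
- by move=> t; apply: contraNneq => e; rewrite /gp e maxxx.
- by apply: lt => t; rewrite /gp ge_max normr_ge0 ler_norm.
- by move=> t; rewrite /gn le_max lexx orbT.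
- by move=> t; apply: contraNneq => e; rewrite /gn e oppr0 maxxx.
- by apply: lt => t; rewrite /gn ge_max normr_ge0 -normrN ler_norm.
Qed.

End Exhaustion.

(** * Fillings of a diagram as grids of numbers *)

Section BoxGrid.
Variables (L B : nat) (nu : intpart).
Hypotheses (szL : (size nu <= L)%N) (hdB : (head 0%N nu <= B)%N).
Let nr := rows_of L B nu.

Let nrE (i : 'I_L) : nr i = nth 0%N nu i :> nat.
Proof. by rewrite -partE part_rows_of. Qed.

Let colB (i : nat) : (nth 0%N nu i <= B)%N.
Proof. exact: leq_trans (nth_le_head nu i) hdB. Qed.

Definition cell (b : box nu) : 'I_L * 'I_B :=
  (widen_ord szL (tag b), widen_ord (colB (tag b)) (tagged b)).

Lemma cell_row b : (cell b).1 = brow b :> nat. Proof. by []. Qed.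
Lemma cell_col b : (cell b).2 = bcol b :> nat. Proof. by []. Qed.

Lemma cell_inj : injective cell.
Proof.
move=> [i j] [i' j'] [/val_inj /= e]; move: j'; rewrite -e => j' /val_inj <-.
by [].
Qed.

Lemma cell_in b : ((cell b).2 < nr (cell b).1)%N.
Proof. by rewrite nrE /=. Qed.

Lemma cell_onto (i : 'I_L) (j : 'I_B) : (j < nr i)%N -> exists b, cell b = (i, j).
Proof.
rewrite nrE => ji.
have iz : (i < size nu)%N.
  by rewrite ltnNge; apply/negP => /(nth_default 0%N) e; rewrite e in ji.
exists (@Tagged 'I_(size nu) (Ordinal iz) (fun i => 'I_(nth 0%N nu i)) (Ordinal ji)).
by congr pair; apply: val_inj.
Qed.

Lemma big_cell (A : Type) (idx : A) (op : Monoid.com_law idx) (F : 'I_L * 'I_B -> A) :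
  \big[op/idx]_(b : box nu) F (cell b) =
  \big[op/idx]_(p : 'I_L * 'I_B | (p.2 < nr p.1)%N) F p.
Proof.
rewrite [RHS](reindex_omap cell (fun p => [pick b | cell b == p])).
  apply: eq_bigl => b; rewrite cell_in /=; case: pickP => [c /eqP/cell_inj ->|/(_ b)].
    by rewrite eqxx.
  by rewrite eqxx.
move=> [i j] /= /cell_onto[b e]; case: pickP => [c /eqP ec|/(_ b)]; first by rewrite /= ec.
by rewrite e eqxx.
Qed.

Lemma card_box : #|{: box nu}| = sumn nu.
Proof.
rewrite -sum1_card (big_cell _ (fun=> 1%N)) sum1_card wsize_card.
exact: wsize_rows_of.
Qed.

Definition tab_of n (f : grid L B n) : filling nu := [ffun b => f (cell b) : nat].

Definition grid_of n (T : filling nu) : grid L B n :=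
  [ffun p => inord (if [pick b | cell b == p] is Some b then T b else 0%N)].

Lemma grid_of_cell n (T : filling nu) b : (T b <= n)%N -> grid_of n T (cell b) = T b :> nat.
Proof.
move=> Tn; rewrite ffunE; case: pickP => [c /eqP/cell_inj ->|/(_ b)]; last by rewrite eqxx.
by rewrite inordK.
Qed.

Lemma grid_of_out n (T : filling nu) (i : 'I_L) (j : 'I_B) :
  (nr i <= j)%N -> grid_of n T (i, j) = 0%N :> nat.
Proof.
move=> out; rewrite ffunE; case: pickP => [c /eqP e|_]; last by rewrite inordK.
by have := cell_in c; rewrite e /= ltnNge out.
Qed.

Lemma tab_ofK n (T : filling nu) : (forall b, T b <= n)%N -> tab_of (grid_of n T) = T.
Proof. by move=> Tn; apply/ffunP => b; rewrite ffunE grid_of_cell. Qed.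

Lemma tab_of_inj n (f f' : grid L B n) : rtab nr f -> rtab nr f' ->
  tab_of f = tab_of f' -> f = f'.
Proof.
move=> /rtabP[h _ _] /rtabP[h' _ _] /ffunP e; apply/ffunP => -[i j]; apply: val_inj => /=.
case: (ltnP j (nr i)) => [/cell_onto[b <-]|out]; first by have := e b; rewrite !ffunE.
have := h i j; have := h' i j; rewrite [(j < _)%N]ltnNge out /=.
by move=> /negbT; rewrite -eqn0Ngt => /eqP -> /negbT; rewrite -eqn0Ngt => /eqP ->.
Qed.

Lemma Tab_tab_of n (f : grid L B n) : rtab nr f -> Tab (tab_of f).
Proof.
move=> /rtabP[h1 h2 h3]; split.
- by move=> b; rewrite ffunE (surjective_pairing (cell b)) h1 cell_in.
- move=> b c rbc cbc; rewrite !ffunE (surjective_pairing (cell b)) (surjective_pairing (cell c)).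
  by rewrite (_ : (cell c).1 = (cell b).1) ?h2 //; apply: val_inj.
- move=> b c cbc rbc; rewrite !ffunE (surjective_pairing (cell b)) (surjective_pairing (cell c)).
  rewrite (_ : (cell c).2 = (cell b).2); last exact: val_inj.
  have := h3 (cell b).1 (cell c).1 (cell b).2 rbc.
  have := h1 (cell b).1 (cell b).2; rewrite cell_in => b0 le.
  by apply: leq_ltn_trans le _; rewrite prednK.
Qed.

Lemma rtab_grid_of n (T : filling nu) : Tab T -> (forall b, T b <= n)%N ->
  rtab nr (grid_of n T).
Proof.
move=> [t1 t2 t3] Tn.
have hp := rows_of_part szL hdB.
apply/rtabP; split.
- move=> i j; case: (ltnP j (nr i)) => [/cell_onto[b <-]|out]; last by rewrite grid_of_out.
  by rewrite grid_of_cell // t1.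
- move=> i j j' jj; case: (ltnP j' (nr i)) => [j'i|out]; last by rewrite grid_of_out.
  have [b eb] := cell_onto (leq_ltn_trans jj j'i); have [c ec] := cell_onto j'i.
  rewrite -eb -ec !grid_of_cell //; apply: t2; rewrite -?cell_row -?cell_col eb ec //.
- move=> i i' j ii; case: (ltnP j (nr i')) => [ji'|out]; last by rewrite grid_of_out.
  have ji : (j < nr i)%N.
    by apply: leq_trans ji' _; have := part_anti hp (ltnW ii); rewrite !partE.
  have [b eb] := cell_onto ji; have [c ec] := cell_onto ji'.
  rewrite -eb -ec !grid_of_cell //.
  have := t3 b c; rewrite -!cell_row -!cell_col eb ec => /(_ erefl ii).
  by case: (T b).
Qed.

End BoxGrid.

(** * Schur coefficients as counts of reverse tableaux *)

Lemma monomial_bound (m : monomial) : exists n, forall i, (n <= i)%N -> m i = 0%N.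
Proof.
exists (\max_(i <- finsupp m) i).+1 => i lt.
apply: fsfun_dflt; apply/negP => im.
by move: lt; rewrite ltnNge (leq_bigmax_seq _ im).
Qed.

Lemma weight_entry_le (nu : intpart) (T : filling nu) (m : monomial) n b :
  (forall i, (n <= i)%N -> m i = 0%N) -> (0 < T b)%N -> has_weight T m -> (T b <= n)%N.
Proof.
move=> m0 Tb w; rewrite leqNgt; apply/negP => lt.
have := w (T b).-1; rewrite m0; last by rewrite -ltnS prednK.
by rewrite prednK // => /card0_eq/(_ b); rewrite !inE eqxx.
Qed.

Lemma SSYT_reverse (nu : intpart) (T T' : filling nu) n :
  (forall b, 0 < T b <= n)%N -> (forall b, T' b = n.+1 - T b)%N -> SSYT T <-> Tab T'.
Proof.
move=> Tn T'E; split=> -[h1 h2 h3]; split.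
- by move=> b; rewrite T'E; have := Tn b; lia.
- by move=> b c rbc cbc; rewrite !T'E; have := h2 b c rbc cbc; lia.
- by move=> b c cbc rbc; rewrite !T'E; have := h3 b c cbc rbc; have := Tn b; have := Tn c; lia.
- by move=> b; have /andP[] := Tn b.
- by move=> b c rbc cbc; have := h2 b c rbc cbc; rewrite !T'E; have := Tn b; have := Tn c; lia.
- by move=> b c cbc rbc; have := h3 b c cbc rbc; rewrite !T'E; lia.
Qed.

Section SchurCoef.
Variables (R : realType) (L B : nat) (nu : intpart).
Hypotheses (szL : (size nu <= L)%N) (hdB : (head 0%N nu <= B)%N).
Let nr := rows_of L B nu.
Let cel := cell szL hdB.

Lemma card_cell n (f : grid L B n) k : rtab nr f ->
  #|[pred p | f p == k.+1 :> nat]| = #|[pred b | f (cel b) == k.+1 :> nat]|.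
Proof.
move=> /rtabP[h _ _].
rewrite -[RHS]sum1_card [RHS]big_mkcond /=
  (big_cell szL hdB _ (fun p => if f p == k.+1 :> nat then 1 else 0)%N).
rewrite -big_mkcondr -sum1_card; apply: eq_bigl => -[i j]; rewrite !inE /=.
by rewrite -h; case: (nat_of_ord _).
Qed.

Definition rev_tab_of n (f : grid L B n) : filling nu := [ffun b => n.+1 - f (cel b)]%N.

(** The bijection replaces each entry by its complement to n + 1, so the entry k + 1 of a reverse
    tableau belongs to the variable of index n - k - 1. *)
Lemma schur_card n (m : monomial) : (forall i, (n <= i)%N -> m i = 0%N) ->
  schur R nu m = #|[pred f : grid L B n | rtab nr f &&
    [forall k : 'I_n, #|[pred p | f p == k.+1 :> nat]| == m (n - k.+1)%N]]|%:R.
Proof.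
move=> m0; rewrite /schur; set P := [pred f | _]; congr _%:R.
rewrite [RHS]cardE -(size_map (@rev_tab_of n)).
have fpos (f : grid L B n) b : rtab nr f -> (0 < f (cel b) <= n)%N.
  move=> /rtabP[h _ _]; rewrite -[(_ <= n)%N]ltnS ltn_ord andbT.
  by rewrite (surjective_pairing (cel b)) h cell_in.
have key2 t : (0 < t <= n -> 0 < n.+1 - t <= n)%N by lia.
have key t k : (0 < t <= n)%N -> (k < n)%N ->
  (n.+1 - t == k.+1)%N = (t == (n - k.+1).+1)%N by lia.
apply/perm_size/uniq_perm; first exact: fset_uniq.
  rewrite map_inj_in_uniq ?enum_uniq // => f f'; rewrite !mem_enum => /andP[hf _] /andP[hf' _].
  move=> /ffunP e; apply: (tab_of_inj hf hf'); apply/ffunP => b; have := e b.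
  by have := fpos f b hf; have := fpos f' b hf'; rewrite !ffunE /cel; lia.
move=> T; rewrite in_fset_set; last exact: finite_weight.
apply/idP/mapP => [/set_mem[hT w]|[f]].
  have Tn b : (0 < T b <= n)%N.
    by have [/(_ b) Tb _ _] := hT; rewrite Tb (weight_entry_le m0 Tb w).
  pose T' : filling nu := [ffun b => n.+1 - T b]%N.
  have T'E b : T' b = (n.+1 - T b)%N by rewrite ffunE.
  have T'n b : (T' b <= n)%N by rewrite T'E; have := Tn b; lia.
  have hT' : Tab T' by apply/(SSYT_reverse Tn T'E).
  have hf := rtab_grid_of szL hdB hT' T'n.
  exists (grid_of szL hdB n T').
    rewrite mem_enum inE hf /=; apply/forallP => k; rewrite card_cell // -w.
    apply/eqP/eq_card => b; rewrite !inE grid_of_cell // T'E.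
    exact: key (Tn b) (ltn_ord k).
  by apply/ffunP => b; rewrite ffunE grid_of_cell // T'E; have := Tn b; lia.
rewrite mem_enum => /andP[hf /forallP hm] ->.
have TE b : rev_tab_of f b = (n.+1 - f (cel b))%N by rewrite ffunE.
have Tn b : (0 < rev_tab_of f b <= n)%N by rewrite TE; exact: key2 (fpos f b hf).
apply/mem_set; split.
  apply/(SSYT_reverse (T' := tab_of szL hdB f) Tn); last exact: Tab_tab_of.
  by move=> b; rewrite TE ffunE subKn // ltnW.
move=> i; case: (ltnP i n) => [ni|ni]; last first.
  rewrite m0 //; apply: eq_card0 => b; rewrite !inE; apply/negbTE/eqP.
  by move=> e; have := Tn b; rewrite e; lia.
have kn : (n - i.+1 < n)%N by lia.
have e : (n - (n - i.+1).+1 = i)%N by lia.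
have /eqP := hm (Ordinal kn); rewrite card_cell //= e => <-.
by apply: eq_card => b; rewrite !inE TE; exact: key (fpos f b hf) ni.
Qed.

(** Reversing entries yields the chain with the variables in the opposite order; commutation of the
    steps restores the order. *)
Lemma schur_chain n (m : monomial) : (forall i, (n <= i)%N -> m i = 0%N) ->
  schur R nu m =
  foldr (fun k => step (wdiff (fun d => (d == m k)%:R))) (@delta0 L B R) (iota 0 n) nr.
Proof.
move=> m0; rewrite (schur_card m0) -sum1_card natr_sum big_mkcondr /=.
transitivity (\sum_(f : grid L B n | rtab nr f)
   \prod_(k < n) (#|[pred p | f p == k.+1 :> nat]| == m (n - k.+1)%N)%:R : R).
  apply: eq_bigr => f _; case: ifPn => [/forallP h|/forallPn[k /negbTE h]].
    by rewrite big1 // => k _; rewrite h.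
  by rewrite (bigD1 k) //= h mul0r.
rewrite (rtab_count R n nr (fun k => m (n - k.+1)%N)) chain_foldr.
transitivity (foldr (fun k => step (wdiff (fun d => (d == m k)%:R)))
  (@delta0 L B R) [seq (n - k.+1)%N | k <- iota 0 n] nr); first by rewrite foldr_map.
congr (_ _); apply: (chain_perm _ _ (fun k d => (d == m k)%:R)); apply: uniq_perm.
- rewrite map_inj_in_uniq ?iota_uniq // => a b; rewrite !mem_iota; lia.
- exact: iota_uniq.
move=> k; rewrite mem_iota /=; apply/mapP/idP => [[a]|kn].
  by rewrite mem_iota /= => an ->; lia.
exists (n - k.+1)%N; rewrite ?mem_iota; lia.
Qed.

(** Thanks to commutation, reverse tableaux may be counted by [m] itself instead of by the reversed
    weight. *)
Lemma schur_tab n (m : monomial) : (forall i, (n <= i)%N -> m i = 0%N) ->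
  schur R nu m = \sum_(f : grid L B n | rtab nr f)
   \prod_(k < n) (#|[pred p | f p == k.+1 :> nat]| == m k)%:R.
Proof. by move=> m0; rewrite (schur_chain m0) rtab_count chain_foldr. Qed.

End SchurCoef.

(** * Symmetry and degree *)

Section SchurSymmetric.
Variable R : realType.

(** Once zero exponents are dropped, both chains run over the support of [m], in two different
    orders. *)
Lemma schur_symmetric (nu : intpart) (s : nat -> nat) (m m' : monomial) :
  bijective s -> (forall i, m' i = m (s i)) -> schur R nu m' = schur R nu m.
Proof.
move=> [t sK tK] m'E.
have [n m0] := monomial_bound m; have [n' m'0] := monomial_bound m'.
rewrite (schur_chain R (leqnn (size nu)) (leqnn (head 0%N nu)) m0).
rewrite (schur_chain R (leqnn (size nu)) (leqnn (head 0%N nu)) m'0).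
transitivity (foldr (fun k => step (wdiff (fun d => (d == m k)%:R)))
   (@delta0 _ _ R) (map s (iota 0 n')) (rows_of (size nu) (head 0%N nu) nu)).
  rewrite foldr_map; congr (foldr _ _ _ _); apply/funext => k; apply/funext => phi.
  by rewrite m'E.
rewrite chain_filter [in RHS]chain_filter.
congr (_ _); apply: (chain_perm _ _ (fun k d => (d == m k)%:R)); apply: uniq_perm.
- by rewrite filter_uniq // map_inj_uniq ?iota_uniq //; exact: can_inj sK.
- by rewrite filter_uniq // iota_uniq.
move=> k; rewrite !mem_filter; case: (eqVneq (m k) 0%N) => //= mk.
rewrite mem_iota /= add0n ltnNge; have -> : (n <= k)%N = false.
  by apply/negP => /m0 e; rewrite e eqxx in mk.
apply/mapP; exists (t k); last by rewrite tK.
rewrite mem_iota /= add0n ltnNge; apply/negP => /m'0 e.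
by move: mk; rewrite -[k]tK -m'E e eqxx.
Qed.

Lemma schur_degree (nu : intpart) (m : monomial) :
  schur R nu m != 0 -> (mondeg m <= sumn nu)%N.
Proof.
rewrite /schur pnatr_eq0 cardfs_eq0 => /fset0Pn[T].
rewrite in_fset_set; last exact: finite_weight.
move=> /set_mem[_ w]; rewrite -(card_box (leqnn (size nu)) (leqnn (head 0%N nu))).
rewrite /mondeg -sum1_card.
under eq_bigr do rewrite -w -sum1_card big_mkcond /=.
rewrite exchange_big /=; apply: leq_sum => b _.
rewrite -big_mkcond sum1_count.
apply: (@leq_trans (count_mem (T b).-1 (finsupp m))); last first.
  by rewrite count_uniq_mem ?fset_uniq //; case: (_ \in _).
by apply: sub_count => i /=; rewrite !inE => /eqP ->.
Qed.

Lemma interpE (q : R) (mu : intpart) (m : monomial) :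
  interp q mu m =
  \sum_(nu <- fset_set [set nu | subdiagram nu mu]) sigma q mu nu * schur R nu m.
Proof.
rewrite /interp fsbig_finite; last exact: finite_subdiagram.
by elim/big_rec2: _ => //= nu x y _ <-.
Qed.

Lemma mem_subdiagrams (mu nu : intpart) :
  (nu \in fset_set [set nu | subdiagram nu mu]) -> subdiagram nu mu.
Proof. by rewrite in_fset_set; [move/set_mem|exact: finite_subdiagram]. Qed.

Lemma subdiagram_sumn (nu mu : intpart) : subdiagram nu mu -> (sumn nu <= sumn mu)%N.
Proof.
move=> sub; have szn := subdiagram_size sub.
have ss (ka : intpart) : (size ka <= size mu)%N ->
    (sumn ka = \sum_(0 <= i < size mu) nth 0 ka i)%N.
  move=> le; rewrite (sumn_truncate le) => [|i ?]; last by rewrite nth_default.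
  by rewrite sumnE [LHS](big_nth 0%N).
by rewrite !ss //; apply: leq_sum => i _; exact: sub.
Qed.

Lemma interp_degree (q : R) (mu : intpart) (m : monomial) :
  interp q mu m != 0 -> (mondeg m <= sumn mu)%N.
Proof.
rewrite interpE leqNgt; apply: contraNN => lt; rewrite big_seq big1 // => nu /mem_subdiagrams sub.
rewrite [schur R nu m](_ : _ = 0) ?mulr0 //; apply/eqP; apply: contraTT lt => /schur_degree le.
rewrite -leqNgt; exact: leq_trans le (subdiagram_sumn sub).
Qed.

Lemma interp_symmetric (q : R) (mu : intpart) : symmetric_function (interp q mu).
Proof.
split; first by exists (sumn mu) => m; exact: interp_degree.
move=> s bs m m' mm'; rewrite !interpE; apply: eq_bigr => nu _.
by rewrite (schur_symmetric _ bs mm').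
Qed.

End SchurSymmetric.

(** * Evaluation in finitely many variables *)

Section Monomials.
Variable R : realType.

Definition mono_of n d (e : {ffun 'I_n -> 'I_d.+1}) : monomial :=
  [fsfun i in [fset k in iota 0 n]%fset => oapp (fun k : 'I_n => e k : nat) 0%N (insub i)].

Lemma mono_ofE n d (e : {ffun 'I_n -> 'I_d.+1}) (k : 'I_n) : mono_of e k = e k.
Proof. by rewrite fsfunE !inE /= mem_iota /= add0n ltn_ord valK. Qed.

Lemma mono_of_out n d (e : {ffun 'I_n -> 'I_d.+1}) i : (n <= i)%N -> mono_of e i = 0%N.
Proof. by move=> ni; rewrite fsfunE !inE /= mem_iota /= add0n ltnNge ni. Qed.

Lemma mono_prod (X : nat -> R) (m : monomial) n : (forall i, (n <= i)%N -> m i = 0%N) ->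
  \prod_(i <- finsupp m) X i ^+ m i = \prod_(k < n) X k ^+ m k.
Proof.
move=> m0; rewrite -(big_mkord predT (fun k => X k ^+ m k)).
rewrite [RHS](bigID (fun k => k \in finsupp m)) /= [X in _ * X]big1 ?mulr1; last first.
  by move=> k; rewrite mem_finsupp negbK => /eqP ->; rewrite expr0.
rewrite -[RHS]big_filter; apply/perm_big/uniq_perm; rewrite ?filter_uniq ?iota_uniq ?fset_uniq //.
move=> k; rewrite mem_filter mem_index_iota /=; apply/idP/andP => [km|[]//]; split=> //.
by rewrite ltnNge; apply/negP => /m0 e; move: km; rewrite mem_finsupp e eqxx.
Qed.

(** Bounding the exponents by [d] keeps the list finite while every monomial of degree at most [d]
    appears once [n] is large. *)
Definition mono_seq d n : seq monomial :=
  [seq mono_of e | e <- enum {: {ffun 'I_n -> 'I_d.+1}}].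

Lemma mono_exhausts d (f : monomial -> R) : (forall m, f m != 0 -> (mondeg m <= d)%N) ->
  exhausts setT f (mono_seq d).
Proof.
move=> fd; split=> //.
  move=> n; rewrite map_inj_uniq ?enum_uniq // => e e' ee.
  by apply/ffunP => k; apply/val_inj; rewrite /= -!mono_ofE ee.
move=> m _ fm; have [N m0] := monomial_bound m; exists N => n Nn.
have md k : (m k < d.+1)%N.
  rewrite ltnS; apply: leq_trans (fd m fm); rewrite /mondeg.
  case: (boolP (k \in finsupp m)) => [km|]; last by rewrite mem_finsupp negbK => /eqP ->.
  by rewrite (bigD1_seq k) ?fset_uniq //= leq_addr.
apply/mapP; exists [ffun k : 'I_n => inord (m k)]; first by rewrite mem_enum.
apply/fsfunP => i; case: (ltnP i n) => [ni|ni].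
  by rewrite (mono_ofE _ (Ordinal ni)) ffunE inordK.
by rewrite mono_of_out // m0 // (leq_trans Nn).
Qed.

Lemma sum_mono_seq d n (f : monomial -> R) :
  \sum_(m <- mono_seq d n) f m = \sum_(e : {ffun 'I_n -> 'I_d.+1}) f (mono_of e).
Proof. by rewrite big_map big_enum. Qed.

(** Exchanging the sums leaves, for each tableau, the single exponent vector that counts its
    entries; d >= |nu| guarantees that this vector is in range. *)
Lemma schur_poly L B (nu : intpart) (szL : (size nu <= L)%N) (hdB : (head 0%N nu <= B)%N)
    n d (X : nat -> R) : (sumn nu <= d)%N ->
  \sum_(e : {ffun 'I_n -> 'I_d.+1}) schur R nu (mono_of e) * \prod_(k < n) X k ^+ e k =
  chain n (fun k => wdiff (fun a => X k ^+ a)) (@delta0 L B R) (rows_of L B nu).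
Proof.
move=> nd; set nr := rows_of L B nu.
pose cnt (f : grid L B n) (k : nat) := #|[pred p | f p == k.+1 :> nat]|.
transitivity (\sum_(f : grid L B n | rtab nr f) \prod_(k < n) X k ^+ cnt f k).
  under eq_bigr => e _.
    rewrite (schur_tab R szL hdB (@mono_of_out n d e)) big_distrl /=.
    over.
  rewrite exchange_big /=; apply: eq_bigr => f hf.
  transitivity (\sum_(e : {ffun 'I_n -> 'I_d.+1})
     \prod_(k < n) ((cnt f k == e k)%:R * X k ^+ e k)).
    apply: eq_bigr => e _; rewrite -big_split /=; apply: eq_bigr => k _.
    by rewrite mono_ofE.
  rewrite -(bigA_distr_bigA (fun (k : 'I_n) (a : 'I_d.+1) => (cnt f k == a)%:R * X k ^+ a)) /=.
  apply: eq_bigr => k _.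
  have cd : (cnt f k < d.+1)%N.
    rewrite ltnS (leq_trans _ nd) // -(wsize_rows_of szL hdB) -wsize_card.
    apply/subset_leq_card/fintype.subsetP => -[i j]; rewrite !inE /= => /eqP fk.
    by have /rtabP[<- _ _] := hf; rewrite fk.
  have key (a : 'I_d.+1) : cnt f k = a -> a = Ordinal cd by move=> e; apply: val_inj.
  rewrite (bigD1 (Ordinal cd)) //= eqxx mul1r big1 ?addr0 // => a /eqP ne.
  case: eqP => [e|_]; last by rewrite mul0r.
  by case: ne; exact: key e.
transitivity (chain n (wstrip (fun k _ => X k)) (@delta0 L B R) nr); last first.
  elim: n X {cnt} nr => //= n IH X nr; apply: eq_bigr => lam il.
  by rewrite wstrip_cst // IH.
rewrite -rtab_prod; apply: eq_bigr => f /rtabP[h _ _].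
transitivity (\prod_(k < n) \prod_(p | f p == k.+1 :> nat) X k).
  by apply: eq_bigr => k _; rewrite prodr_const.
rewrite (exchange_big_dep (fun p : 'I_L * 'I_B => p.2 < nr p.1)%N) /=; last first.
  by move=> k [i j] _ /= /eqP fk; rewrite -h fk.
apply: eq_bigr => -[i j] /=; rewrite -h => f0.
have kn : ((f (i, j)).-1 < n)%N by rewrite prednK // -ltnS ltn_ord.
rewrite (big_pred1 (Ordinal kn)) // => k; rewrite /= -{1}(prednK f0) eqSS eq_sym.
by apply/eqP/eqP => [e|->] //; apply: val_inj; rewrite /= e.
Qed.

End Monomials.

(** * Sums over the subdiagrams of mu *)

Lemma rows_of_onto L B (nu : rows L B) : is_part nu ->
  exists2 ka : intpart, (size ka <= L)%N && (head 0%N ka <= B)%N & rows_of L B ka = nu.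
Proof.
move=> nup; pose c := #|[pred i : 'I_L | 0 < nu i]%N|.
have hc i : (i < c)%N = (0 < part nu i)%N.
  case: (ltnP i L) => [iL|Li]; last first.
    rewrite part_default // ltnNge (leq_trans _ Li) //.
    by rewrite /c -[X in (_ <= X)%N]card_ord max_card.
  rewrite (partE nu (Ordinal iL)) -[in LHS](erefl : nat_of_ord (Ordinal iL) = i).
  rewrite (@downclosed_card L (fun i => 0 < nu i)%N) // => j j' jj; rewrite -!partE => h.
  exact: leq_trans h (part_anti nup jj).
have pk : is_intpart (mkseq (part nu) c).
  apply/andP; split.
    apply/(sortedP 0%N) => i; rewrite size_mkseq => ic.
    by rewrite !nth_mkseq ?(ltnW ic) // /geq /=; move/is_partP: nup; apply.
  by apply/mapP => -[i]; rewrite mem_iota /= hc => /[swap] <-.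
have nthE i : nth 0%N (mkseq (part nu) c) i = part nu i.
  case: (ltnP i c) => [ic|ci]; first by rewrite nth_mkseq.
  rewrite nth_default ?size_mkseq //; apply/esym/eqP; rewrite -leqn0 leqNgt -hc -leqNgt //.
have szc : (size (mkseq (part nu) c) <= L)%N.
  by rewrite size_mkseq /c -[X in (_ <= X)%N]card_ord max_card.
have hdc : (head 0%N (mkseq (part nu) c) <= B)%N by rewrite -nth0 nthE part_le.
exists (Intpart pk); first by rewrite /= szc hdc.
by apply: rows_eq => i j; rewrite -!partE part_rows_of //= nthE.
Qed.

Lemma rows_of_inj L B (nu ka : intpart) :
  (size nu <= L)%N -> (head 0%N nu <= B)%N -> (size ka <= L)%N -> (head 0%N ka <= B)%N ->
  rows_of L B nu = rows_of L B ka -> nu = ka.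
Proof.
move=> sn hn sk hk e.
have nthE i : nth 0%N nu i = nth 0%N ka i by rewrite -(part_rows_of _ sn hn) e part_rows_of.
have s1 : subdiagram nu ka by move=> i; rewrite nthE.
have s2 : subdiagram ka nu by move=> i; rewrite nthE.
apply: val_inj; apply: (@eq_from_nth _ 0%N) => //.
by apply/eqP; rewrite eqn_leq !subdiagram_size.
Qed.

(** Turns the sum defining I_mu into one over the whole finite type [rows], where it can be
    exchanged with chains. *)
Lemma sum_subdiagrams (A : nmodType) (mu : intpart)
    (G : rows (size mu) (head 0%N mu) -> A) :
  (forall nu, ~~ is_part nu -> G nu = 0) ->
  (forall nu k, is_part nu -> (nth 0 mu k < part nu k)%N -> G nu = 0) ->
  \sum_(nu <- fset_set [set nu | subdiagram nu mu])
     G (rows_of (size mu) (head 0%N mu) nu) = \sum_nu G nu.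
Proof.
move=> G1 G2; set L := size mu; set B := head 0%N mu.
pose S := fset_set [set nu | subdiagram nu mu].
pose C (nu : rows L B) := is_part nu && [forall i : 'I_L, nu i <= nth 0 mu i]%N.
transitivity (\sum_(nu | C nu) G nu); last first.
  rewrite [RHS](bigID C) /= [X in _ + X]big1 ?addr0 // => nu.
  rewrite negb_and; case: (boolP (is_part nu)) => /= nup; last by move=> _; exact: G1.
  by move=> /forallPn[k]; rewrite -ltnNge => lt; apply: (G2 _ k) => //; rewrite partE.
rewrite -[RHS]big_enum -(big_map (rows_of L B) predT G).
apply/perm_big/uniq_perm.
- rewrite map_inj_in_uniq ?fset_uniq // => a b /mem_subdiagrams sa /mem_subdiagrams sb.
  by apply: rows_of_inj; rewrite ?subdiagram_size ?subdiagram_head.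
- exact: enum_uniq.
move=> nu; rewrite mem_enum; apply/mapP/andP => [[ka /mem_subdiagrams sub ->]|[nup /forallP le]].
  have sz := subdiagram_size sub; have hd := subdiagram_head sub.
  split; first exact: rows_of_part.
  by apply/forallP => i; rewrite -partE part_rows_of.
have [ka /andP[sz hd] e] := rows_of_onto nup; exists ka => //.
rewrite in_fset_set; last exact: finite_subdiagram.
apply/mem_set => i; rewrite -(part_rows_of i sz hd) e.
case: (ltnP i L) => [iL|Li]; last by rewrite part_default.
by rewrite (partE _ (Ordinal iL)); exact: (le (Ordinal iL)).
Qed.

(** * Bounds uniform in the number of variables *)

Section ChainExtra.
Variables (R : realType) (L B : nat).
Implicit Types (mu nu lam : rows L B).

Lemma chainB n (w : nat -> rows L B -> rows L B -> R) (phi psi : rows L B -> R) mu :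
  chain n w (fun lam => phi lam - psi lam) mu = chain n w phi mu - chain n w psi mu.
Proof.
elim: n w mu => //= n IH w mu; rewrite /step -sumrB.
by apply: eq_bigr => lam _; rewrite IH mulrBr.
Qed.

Lemma prod_le_expR (y : nat -> R) n : (forall k, 0 <= y k) ->
  \prod_(0 <= k < n) (1 + y k) <= expR (\sum_(0 <= k < n) y k).
Proof.
move=> y0; elim: n => [|n IH]; first by rewrite !big_geq // expR0.
rewrite !big_nat_recr //= expRD ler_pM ?expR_ge1Dx //.
  by rewrite prodr_ge0 // => k _; rewrite addr_ge0.
by rewrite addr_ge0.
Qed.

(** Bounded partial sums of [y] bound the products of 1 + y k through the exponential, independently
    of [n]. *)
Lemma chain_bounded n (w : nat -> rows L B -> rows L B -> R) (phi : rows L B -> R)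
    (y : nat -> R) (C M : R) mu :
  (forall k, 0 <= y k) -> (forall n, \sum_(0 <= k < n) y k <= M) ->
  (forall k nu lam, interlace nu lam -> `|w k nu lam| <= y k ^+ (wsize nu - wsize lam)) ->
  (forall lam, `|phi lam| <= C) ->
  `|chain n w phi mu| <= C * expR M ^+ wsize mu.
Proof.
move=> y0 yM hw hphi.
have C0 : 0 <= C by apply: le_trans (hphi mu).
apply: le_trans (chain_bound n mu y0 C0 hw hphi) _.
rewrite ler_wpM2l // lerXn2r ?nnegrE ?expR_ge0 //.
  by rewrite prodr_ge0 // => k _; rewrite addr_ge0.
by apply: le_trans (prod_le_expR _ y0) _; rewrite ler_expR.
Qed.

Lemma wstrip_le (g : nat -> 'I_L * 'I_B -> R) (y : nat -> R) k mu lam :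
  (forall k p, `|g k p| <= y k) -> interlace mu lam ->
  `|wstrip g k mu lam| <= y k ^+ (wsize mu - wsize lam).
Proof.
move=> gy il; rewrite /wstrip normr_prod -strip_card // -prodr_const.
by apply: ler_prod => p _; rewrite normr_ge0 gy.
Qed.

Lemma delta0_le (mu : rows L B) : `|delta0 R mu| <= 1.
Proof. by rewrite /delta0; case: eqP => _; rewrite ?normr1 ?normr0. Qed.

End ChainExtra.

(** * Iterating the branching rule *)

Section Interpolation.
Variables (R : realType) (q : R).
Hypothesis hq : 0 < q < 1.

Let q0 : 0 < q. Proof. by case/andP: hq. Qed.
Let q1 : q < 1. Proof. by case/andP: hq. Qed.

Section Iteration.
Variables L B : nat.
Implicit Types (mu nu lam : rows L B) (X : nat -> R).

(** The factor of a box with entry k + 1; at s = 1 it is x_T - q^(T + i - j - 1) with T = k + 1. *)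
Definition node_weight X (s : R) (k : nat) (p : 'I_L * 'I_B) : R :=
  X k - s * q ^+ k * q ^ (p.1%:Z - p.2%:Z).

(** Each use of [sig_branching] moves one variable from the Schur side to the tableau side and
    multiplies the parameter by q. After [n] steps the end function is [sig] at s q^n, where a
    tableau sum would have [delta0]. *)
Lemma sig_chain n X s mu : is_part mu ->
  \sum_nu sig q s mu nu * chain n (fun k => wdiff (fun a => X k ^+ a)) (@delta0 L B R) nu =
  chain n (wstrip (node_weight X s)) (fun lam => sig q (s * q ^+ n) lam [ffun=> ord0]) mu.
Proof.
elim: n X s mu => [|n IH] X s mu mup /=.
  rewrite (bigD1 [ffun=> ord0]) //= big1 ?addr0; last first.
    by move=> nu /negbTE ne; rewrite /delta0 ne mulr0.
  by rewrite /delta0 eqxx !mulr1.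
set P := chain n _ _.
(* [sig_branching] applies to partitions [kap] only; all other terms vanish. *)
have Pp : on_parts P.
  rewrite /P; case: n {IH P} => [|n] /=; [exact: on_parts_delta0|exact: on_parts_step].
transitivity (\sum_kap P kap *
   \sum_(nu | interlace nu kap) X 0%N ^+ (wsize nu - wsize kap) * sig q s mu nu).
  under eq_bigr do rewrite /step big_distrr /=.
  rewrite (exchange_big_dep predT) //=; apply: eq_bigr => kap _.
  rewrite big_distrr /=; apply: eq_bigr => nu _.
  by rewrite mulrA [LHS]mulrC [in LHS](mulrC (sig _ _ _ _)).
transitivity (\sum_kap P kap * \sum_(lam | interlace mu lam)
    wstrip (node_weight X s) 0 mu lam * sig q (s * q) lam kap).
  apply: eq_bigr => kap _; case: (boolP (is_part kap)) => kapp; last by rewrite Pp // !mul0r.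
  rewrite -(sig_branching hq s (X 0%N) mup kapp); congr (_ * _).
  apply: eq_bigr => lam _; congr (_ * _); apply: eq_bigr => p _.
  by rewrite /node_weight expr0 mulr1.
under eq_bigr do rewrite big_distrr /=.
rewrite (exchange_big_dep (interlace mu)) //=; apply: eq_bigr => lam il.
(* Dropping the first variable and replacing s by s q shifts the index of the nodes by one. *)
have shift : (fun k => node_weight X s k.+1) = node_weight (fun k => X k.+1) (s * q).
  by apply/funext => k; apply/funext => p; rewrite /node_weight exprS !mulrA.
change (fun k : nat => wstrip (node_weight X s) k.+1) with
  (wstrip (L := L) (B := B) (fun k => node_weight X s k.+1)).
rewrite shift.
rewrite exprS mulrA -IH ?(interlace_part2 il) // big_distrr /=.
by apply: eq_big => [kap|kap _]; rewrite ?il // mulrCA [P kap * _]mulrC.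
Qed.

(** Column indices stay below [B], so q^(i - j) is at most q^(-B), and the bound no longer depends
    on the box. *)
Lemma node_weight_le X k (p : 'I_L * 'I_B) :
  `|X k| + `|q ^+ k * q ^ (p.1%:Z - p.2%:Z)| <= `|X k| + q ^+ k / q ^+ B.
Proof.
have qk : 0 <= q ^+ k by rewrite exprn_ge0 // ltW.
have qz : 0 <= q ^ (p.1%:Z - p.2%:Z) by rewrite exprz_ge0 // ltW.
rewrite lerD2l ger0_norm ?mulr_ge0 //; apply: ler_wpM2l => //.
rewrite expfzDr ?lt0r_neq0 // -invr_expz -!exprnP -[leRHS]mul1r.
have qe m : 0 <= q ^+ m by rewrite exprn_ge0 // ltW.
have e1 : q ^+ p.1 <= 1 by rewrite exprn_ile1 // ltW.
apply: ler_pM => //; first by rewrite invr_ge0.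
by rewrite lef_pV2 ?posrE ?exprn_gt0 // ler_wiXn2l ?ltW // ltnW.
Qed.

End Iteration.
End Interpolation.

(** * Sums over tableaux with bounded entries *)

Section TabSums.
Variables (R : realType) (q : R).
Hypothesis hq : 0 < q < 1.
Variable mu : intpart.

Let L := size mu.
Let B := head 0%N mu.
Let mr := rows_of L B mu.
Let cel : box mu -> 'I_L * 'I_B := cell (leqnn L) (leqnn B).

Definition tab_seq n : seq (filling mu) :=
  [seq tab_of (leqnn L) (leqnn B) f | f <- enum [pred f : grid L B n | rtab mr f]].

Lemma tab_seq_exhausts (f : filling mu -> R) : exhausts (@Tab mu) f tab_seq.
Proof.
split.
- move=> n; rewrite map_inj_in_uniq ?enum_uniq // => g g'; rewrite !mem_enum.
  exact: tab_of_inj.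
- by move=> n T /mapP[g]; rewrite mem_enum => hg ->; exact: Tab_tab_of.
- move=> T hT _; exists (\max_(b : box mu) T b)%N => n le.
  have Tn b : (T b <= n)%N by apply: leq_trans le; exact: (leq_bigmax b).
  apply/mapP; exists (grid_of (leqnn L) (leqnn B) n T); last by rewrite tab_ofK.
  by rewrite mem_enum; exact: rtab_grid_of.
Qed.

Lemma tab_seq_pos n T b : T \in tab_seq n -> (0 < T b)%N.
Proof. by move=> /mapP[f]; rewrite mem_enum => /(Tab_tab_of (leqnn L) (leqnn B))[h _ _] ->. Qed.

Lemma tab_sum n (g : nat -> 'I_L * 'I_B -> R) :
  \sum_(T <- tab_seq n) \prod_(b : box mu) g (T b).-1 (cel b) =
  chain n (wstrip g) (@delta0 L B R) mr.
Proof.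
rewrite big_map big_enum -rtab_prod; apply: eq_bigr => f _.
rewrite -(big_cell (leqnn L) (leqnn B) _ (fun p => g (f p).-1 p)).
by apply: eq_bigr => b _; rewrite ffunE.
Qed.

Lemma nodeE (T : filling mu) b : (0 < T b)%N ->
  node q T b = q ^+ (T b).-1 * q ^ ((cel b).1%:Z - (cel b).2%:Z).
Proof.
move=> T0; rewrite exprnP -expfzDr; last by case/andP: hq => /lt0r_neq0.
rewrite /node (cell_row (leqnn L) (leqnn B)) (cell_col (leqnn L) (leqnn B)); congr (q ^ _); lia.
Qed.

End TabSums.

(** * Absolute convergence and passage to the limit *)

Lemma ell1_bound (R : realType) (X : nat -> R) : ell1 X ->
  exists M : R, forall n, \sum_(0 <= k < n) `|X k| <= M.
Proof.
rewrite /ell1 /= /summable => fin.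
have ge0 : (0 <= \esum_(i in setT) `|(EFin \o X) i|)%E by exact: esum_ge0.
exists (fine (\esum_(i in setT) `|(EFin \o X) i|)%E) => n.
rewrite -lee_fin fineK ?ge0_fin_numE // -sumEFin fsbig_seq ?iota_uniq //.
by apply: ereal_sup_ubound; exists [set` index_iota 0 n] => //; split; first exact: finite_seq.
Qed.

Lemma geometric_sum_le (R : realType) (q : R) n : 0 < q < 1 ->
  \sum_(0 <= k < n) q ^+ k <= (1 - q)^-1.
Proof.
move=> /andP[q0 q1]; have p : 0 < 1 - q by rewrite subr_gt0.
rewrite -[leRHS]mul1r ler_pdivlMr // mulrC -subr_ge0.
elim: n => [|n IH]; first by rewrite big_geq // mulr0 subr0.
suff -> : (1 - q) * \sum_(0 <= k < n.+1) q ^+ k = 1 - q ^+ n.+1.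
  by rewrite opprB addrC subrK exprn_ge0 // ltW.
rewrite big_mkord -opprB mulNr -subrX1 opprB //.
Qed.

Section Main.
Variables (R : realType) (q : R).
Hypothesis hq : 0 < q < 1.
Variables (mu : intpart) (X : nat -> R).
Hypothesis hX : ell1 X.

Let L := size mu.
Let B := head 0%N mu.
Let mr := rows_of L B mu.
Let cel : box mu -> 'I_L * 'I_B := cell (leqnn L) (leqnn B).
(** A majorant, with bounded partial sums, of the factors of all boxes with entry k + 1. *)
Let y k : R := `|X k| + q ^+ k / q ^+ B.

Let q0 : 0 < q. Proof. by case/andP: hq. Qed.

Let y_ge0 k : 0 <= y k.
Proof. by rewrite addr_ge0 // mulr_ge0 ?invr_ge0 ?exprn_ge0 // ltW. Qed.

Lemma weight_bound : exists M : R, forall n, \sum_(0 <= k < n) y k <= M.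
Proof.
have [M hM] := ell1_bound hX.
exists (M + (1 - q)^-1 / q ^+ B) => n; rewrite big_split /= lerD // -mulr_suml.
by rewrite ler_wpM2r ?geometric_sum_le // invr_ge0 exprn_ge0 // ltW.
Qed.

Let abs_weight k (p : 'I_L * 'I_B) : R := `|X k| + `|q ^+ k * q ^ (p.1%:Z - p.2%:Z)|.

(** One estimate for both series: the product of |x| + |node| dominates the product of the
    differences, and its expansion lists the absolute values of all expanded terms. *)
Lemma tab_abs_bound : exists C : R, forall n,
  \sum_(T <- tab_seq mu n) \prod_(b : box mu) (`|X (T b).-1| + `|node q T b|) <= C.
Proof.
have [M hM] := weight_bound; exists (1 * expR M ^+ wsize mr) => n.
rewrite (_ : \sum_(T <- _) _ = chain n (wstrip abs_weight) (@delta0 L B R) mr); last first.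
  rewrite -tab_sum big_seq [RHS]big_seq; apply: eq_bigr => T hT; apply: eq_bigr => b _.
  by rewrite (nodeE hq (tab_seq_pos b hT)).
apply: le_trans (ler_norm _) _; apply: (chain_bounded _ _ y_ge0 hM).
  move=> k nu lam il; apply: wstrip_le => // {}k p.
  rewrite ger0_norm ?addr_ge0 //; exact: (node_weight_le hq).
exact: delta0_le.
Qed.

Lemma tab_summable : summable (@Tab mu)
  (fun T => (\prod_(b : box mu) (X (T b).-1 - node q T b))%:E).
Proof.
have [C hC] := tab_abs_bound.
pose f (T : filling mu) := \prod_(b : box mu) (X (T b).-1 - node q T b).
suff H n : \sum_(T <- tab_seq mu n) `|f T| <= C.
  exact: (exhausts_summable (tab_seq_exhausts f) H).
apply: le_trans (hC n); apply: ler_sum => T _; rewrite normr_prod.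
by apply: ler_prod => b _; rewrite normr_ge0 ler_normB.
Qed.

Lemma tab_summable_expanded : summable [set TA : filling mu * {set box mu} | Tab TA.1]
  (fun TA => (\prod_(b : box mu)
     (if b \in TA.2 then X (TA.1 b).-1 else - node q TA.1 b))%:E).
Proof.
have [C hC] := tab_abs_bound.
pose f (TA : filling mu * {set box mu}) :=
  \prod_(b : box mu) (if b \in TA.2 then X (TA.1 b).-1 else - node q TA.1 b).
pose s n := [seq (T, A) | T <- tab_seq mu n, A <- enum {: {set box mu}}].
(* The constant function 1 forces the lists to reach every tableau, whatever the value of its
   product. *)
have [u1 u2 u3] := tab_seq_exhausts (fun=> 1 : R) (mu := mu).
have es : exhausts [set TA : filling mu * {set box mu} | Tab TA.1] f s.
  split.
  - by move=> n; apply: allpairs_uniq; rewrite ?enum_uniq //; move=> [? ?] [? ?].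
  - by move=> n _ /allpairsP[[T A] /= [hT _ ->]]; exact: u2 hT.
  - move=> [T A] /= hT _; have [N h] := u3 T hT (oner_neq0 _); exists N => n /h Tn.
    by apply/allpairsP; exists (T, A); rewrite mem_enum.
suff H n : \sum_(TA <- s n) `|f TA| <= C by exact: (exhausts_summable es H).
rewrite big_allpairs; apply: le_trans (hC n); apply: ler_sum => T _.
rewrite bigA_distr big_enum /=; apply: ler_sum => A _; rewrite normr_prod.
by apply: ler_prod => b _; rewrite normr_ge0 /=; case: ifP; rewrite ?normrN.
Qed.

Let wX (Z : nat -> R) k : rows L B -> rows L B -> R := wdiff (fun a => Z k ^+ a).

(** The coefficients are arbitrary so as to cover both I_mu itself and its majorant with |sigma| and
    |X|. *)
Lemma interp_poly (c : intpart -> R) n (Z : nat -> R) :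
  \sum_(e : {ffun 'I_n -> 'I_(sumn mu).+1})
    (\sum_(nu <- fset_set [set nu | subdiagram nu mu]) c nu * schur R nu (mono_of e))
      * \prod_(k < n) Z k ^+ e k =
  \sum_(nu <- fset_set [set nu | subdiagram nu mu])
    c nu * chain n (wX Z) (@delta0 L B R) (rows_of L B nu).
Proof.
under eq_bigr do rewrite big_distrl /=.
rewrite exchange_big /= big_seq [RHS]big_seq; apply: eq_bigr => nu /mem_subdiagrams sub.
have sz : (size nu <= L)%N by exact: subdiagram_size.
have hd : (head 0%N nu <= B)%N by exact: subdiagram_head.
rewrite -(schur_poly sz hd n Z (subdiagram_sumn sub)) big_distrr /=.
by apply: eq_bigr => e _; rewrite mulrA.
Qed.

Let term (m : monomial) := interp q mu m * \prod_(i <- finsupp m) X i ^+ m i.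

Let termE n (e : {ffun 'I_n -> 'I_(sumn mu).+1}) :
  term (mono_of e) = interp q mu (mono_of e) * \prod_(k < n) X k ^+ e k.
Proof.
rewrite /term (mono_prod X (@mono_of_out n _ e)); congr (_ * _).
by apply: eq_bigr => k _; rewrite mono_ofE.
Qed.

Lemma term_exhausts : exhausts setT term (mono_seq (sumn mu)).
Proof.
apply: mono_exhausts => m; rewrite /term mulf_eq0 negb_or => /andP[h _].
exact: interp_degree h.
Qed.

(** Schur coefficients are nonnegative, so the absolute terms are dominated by Schur polynomials at
    |X|, which are bounded uniformly in [n]. *)
Lemma term_summable : summable setT (EFin \o term).
Proof.
have [M hM] := ell1_bound hX.
pose S := fset_set [set nu | subdiagram nu mu].
suff H n : \sum_(m <- mono_seq (sumn mu) n) `|term m| <=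
    \sum_(nu <- S) `|sigma q mu nu| * (1 * expR M ^+ wsize (rows_of L B nu)).
  exact: (exhausts_summable term_exhausts H).
rewrite sum_mono_seq.
apply: (@le_trans _ _ (\sum_(nu <- S) `|sigma q mu nu| *
   chain n (wX (fun k => `|X k|)) (@delta0 L B R) (rows_of L B nu))).
  rewrite -interp_poly; apply: ler_sum => e _.
  rewrite termE interpE normrM normr_prod; apply: ler_pM => //.
  - by rewrite prodr_ge0.
  - apply: le_trans (ler_norm_sum _ _ _) _; apply: ler_sum => nu _.
    by rewrite normrM [X in _ * X <= _]ger0_norm // /schur.
  - by apply: ler_prod => k _; rewrite normr_ge0 normrX lexx.
apply: ler_sum => nu _; rewrite ler_wpM2l //; apply: le_trans (ler_norm _) _.
apply: (@chain_bounded _ _ _ _ _ _ (fun k => `|X k|)) => //.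
  by move=> k ka lam _; rewrite normrX normr_id.
exact: delta0_le.
Qed.

(** [sig_sigma] rewrites the truncated evaluation with [sig] at s = 1, to which [sig_chain]
    applies. *)
Lemma term_sum n : \sum_(m <- mono_seq (sumn mu) n) term m =
  chain n (wstrip (node_weight q X 1)) (fun lam => sig q (1 * q ^+ n) lam [ffun=> ord0]) mr.
Proof.
rewrite sum_mono_seq.
have mrp : is_part mr by exact: rows_of_part.
rewrite -(sig_chain hq n X 1 mrp).
rewrite -(sum_subdiagrams (G := fun nu => sig q 1 mr nu * chain n (wX X) (@delta0 L B R) nu)).
- under eq_bigr do rewrite termE interpE.
  rewrite interp_poly big_seq [RHS]big_seq; apply: eq_bigr => nu /mem_subdiagrams sub.
  by rewrite -(sig_sigma hq sub).
- move=> nu np; case: n => [|n] /=; first by rewrite on_parts_delta0 ?mulr0.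
  by rewrite on_parts_step ?mulr0.
- by move=> nu k np lt; rewrite (sig_eq0 hq _ (k := k) mrp np) ?mul0r // part_rows_of.
Qed.

Lemma tab_seq_sum n :
  \sum_(T <- tab_seq mu n) \prod_(b : box mu) (X (T b).-1 - node q T b) =
  chain n (wstrip (node_weight q X 1)) (@delta0 L B R) mr.
Proof.
rewrite -tab_sum big_seq [RHS]big_seq; apply: eq_bigr => T hT; apply: eq_bigr => b _.
by rewrite (nodeE hq (tab_seq_pos b hT)) /node_weight mul1r.
Qed.

(** By homogeneity the value at [lam] carries the factor q^(n |lam|): it is 1 for the empty shape
    and of order q^n for the finitely many others. *)
Lemma sig_delta0_le : exists C : R, forall n (lam : rows L B),
  `|sig q (1 * q ^+ n) lam [ffun=> ord0] - delta0 R lam| <= C * q ^+ n.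
Proof.
have qn n : 0 <= q ^+ n by rewrite exprn_ge0 // ltW.
exists (\sum_(lam : rows L B) `|sig q 1 lam [ffun=> ord0]|) => n lam; rewrite /delta0.
case: eqP => [->|ne].
  by rewrite (sig0 hq) subrr normr0 mulr_ge0 // sumr_ge0.
rewrite subr0 mulrC (sig_scale q 1 lam [ffun=> ord0] (expf_neq0 n (lt0r_neq0 q0))).
have w0 : wsize ([ffun=> ord0] : rows L B) = 0%N.
  by rewrite /wsize big1 // => i _; rewrite ffunE.
rewrite w0 expr0 divr1 normrM mulrC; apply: ler_pM => //.
  by rewrite (bigD1 lam) //= lerDl sumr_ge0.
rewrite (ger0_norm (exprn_ge0 _ (qn n))) -exprM.
have : (0 < wsize lam)%N.
  rewrite lt0n; apply/negP => /eqP e; apply: ne; apply/esym/wsize_inj_le; last by rewrite w0.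
  by move=> i; rewrite ffunE.
move=> w; have q1 : q <= 1 by case/andP: hq => _ /ltW.
by apply: ler_wiXn2l; rewrite ?(ltW q0) // leq_pmulr.
Qed.

(** The truncations of both sides are one chain operator applied to two end functions. By linearity
    and [sig_delta0_le] they differ by at most a constant times q^n, so their limits agree. *)
Lemma evalX_interp : evalX (interp q mu) X =
  abs_sum (@Tab mu) (fun T => \prod_(b : box mu) (X (T b).-1 - node q T b)).
Proof.
have h1 := exhausts_cvg term_exhausts term_summable.
have h2 := exhausts_cvg (tab_seq_exhausts _) tab_summable.
have [M hM] := weight_bound; have [C hC] := sig_delta0_le.
set E := abs_sum _ term in h1; set T := abs_sum _ _ in h2.
rewrite -[LHS]/E -[RHS]/T; apply/eqP; rewrite -subr_eq0; apply/eqP.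
apply: (cvg_unique _ (cvgB h1 h2)); first exact: norm_hausdorff.
pose K := C * expR M ^+ wsize mr.
have bnd n : `|\sum_(m <- mono_seq (sumn mu) n) term m -
    \sum_(T <- tab_seq mu n) \prod_(b : box mu) (X (T b).-1 - node q T b)| <= K * q ^+ n.
  rewrite term_sum tab_seq_sum -chainB /K mulrAC.
  apply: (chain_bounded _ _ y_ge0 hM) => // k nu lam il; apply: wstrip_le => // {}k p.
  apply: le_trans (ler_normB _ _) _; rewrite mul1r; exact: (node_weight_le hq).
have Kq : (fun n => K * q ^+ n) @ \oo --> 0.
  by apply: cvg_geometric; rewrite (ger0_norm (ltW q0)); case/andP: hq.
apply: (@squeeze_cvgr _ _ _ _ (fun n => - (K * q ^+ n)) (fun n => K * q ^+ n)).
- by apply: nearW => n; rewrite -ler_norml; exact: bnd.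
- by rewrite -[X in _ --> X]oppr0; exact: (cvgN Kq).
- exact: Kq.
Qed.

End Main.

Theorem theorem2p7 (R : realType) (q : R) (hq : 0 < q < 1) (mu : intpart) :
  symmetric_function (interp q mu) /\
  forall X : nat -> R, ell1 X ->
    [/\ summable (@Tab mu)
          (fun T => (\prod_(b : box mu) (X (T b).-1 - node q T b))%:E),
        summable [set TA : filling mu * {set box mu} | Tab TA.1]
          (fun TA => (\prod_(b : box mu)
             (if b \in TA.2 then X (TA.1 b).-1 else - node q TA.1 b))%:E) &
        evalX (interp q mu) X =
          abs_sum (@Tab mu)
            (fun T => \prod_(b : box mu) (X (T b).-1 - node q T b))].
Proof.
split; first exact: interp_symmetric.
move=> X hX; split.
- exact: tab_summable.
- exact: tab_summable_expanded.
- exact: evalX_interp.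
Qed.
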